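(* Let $\mathcal{H}$ be a toric hyperplane arrangement on the $n$-dimensional torus $T^n=\mathbb{R}^n/\mathbb{Z}^n$ that subdivides the torus into regions that are open $n$-dimensional balls. Then the number of regions in the complement $T^n-\bigcup_{H\in\mathcal{H}}H$ is $(-1)^n\cdot\chi(\mathcal{H};t=0)$.
   Context: A toric hyperplane is the image under the quotient map $\mathbb{R}^n\to\mathbb{R}^n/\mathbb{Z}^n$ of a hyperplane $\{\vec x:\vec a\cdot\vec x=b\}$ with $\vec a\in\mathbb{Q}^n\setminus\{0\}$, $b\in\mathbb{R}$; the image of a $k$-dimensional affine subspace with rational coefficient matrix is a $k$-dimensional toric subspace (a $k$-torus). A toric hyperplane arrangement is a finite collection $\{H_1,\dots,H_m\}$ of toric hyperplanes. Its intersection poset $\mathcal{P}$ consists of all connected components of all intersections $\bigcap_{i\in S}H_i$, $S\subseteq\{1,\dots,m\}$ (the empty intersection being $T^n$), together with $\emptyset$, ordered by reverse inclusion, with minimum $\hat0=T^n$. The toric characteristic polynomial is $\chi(\mathcal{H};t)=\sum_{x\in\mathcal{P},\,x\ne\emptyset}\mu(\hat0,x)\,t^{\dim x}$, with $\mu$ the Möbius function of $\mathcal{P}$. *)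

(* Defs.v *)
From HB Require Import structures.
From mathcomp Require Import all_boot all_order all_algebra.
From mathcomp Require Import finmap.
From mathcomp Require Import all_classical all_reals all_analysis.

Set Implicit Arguments.
Unset Strict Implicit.
Unset Printing Implicit Defensive.

Import Order.TTheory GRing.Theory Num.Theory.
Import numFieldNormedType.Exports.

Local Open Scope classical_set_scope.
Local Open Scope ring_scope.
Local Open Scope quotient_scope.

Section Torus.
Context (R : realType) (n : nat).

Definition lattice_rel : rel 'cV[R]_n :=
  fun x y => [forall i, x i 0 - y i 0 \is a Num.int].

Lemma lattice_rel_equiv : equiv_class_of lattice_rel.
Proof.
split=> [x|x y|y x z].
- by apply/forallP => i; rewrite subrr rpred0.
- by apply: eq_forallb => i; rewrite -opprB rpredN.
- move=> /forallP xy /forallP yz; apply/forallP => i.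
  by rewrite -(subrKA (y i 0)) rpredD.
Qed.

Canonical lattice_equiv_rel := EquivRelPack lattice_rel_equiv.

Definition torus : Type := quotient_topology {eq_quot lattice_equiv_rel}.

HB.instance Definition _ := Topological.copy torus
  (quotient_topology {eq_quot lattice_equiv_rel}).

Definition torus_proj : 'cV[R]_n -> torus :=
  \pi_(quotient_topology {eq_quot lattice_equiv_rel}).

Lemma torus_projP (x y : 'cV[R]_n) :
  torus_proj x = torus_proj y <->
  exists z : 'cV[int]_n, x - y = map_mx intr z.
Proof.
have -> : (torus_proj x = torus_proj y) <-> lattice_rel x y.
  by split=> [/eqmodP|xy]; last exact/eqmodP.
split=> [/forallP xy|[z xyz]].
  exists (map_mx Num.floor (x - y)); apply/matrixP => i j.
  by rewrite (ord1 j) !mxE floorK.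
apply/forallP => i; have := congr1 (fun M : 'cV_n => M i 0) xyz.
by rewrite !mxE => ->; rewrite intr_int.
Qed.

Definition toric_hyperplane (V : set torus) : Prop :=
  exists (a : 'cV[rat]_n) (b : R), a != 0 /\
    V = torus_proj @`
      [set x : 'cV[R]_n | \sum_(i < n) ratr (a i 0) * x i 0 = b].

(* A consistent system A x = c, with A of rank r, has an (n - r)-dimensional
   affine solution space. *)
Definition toric_subspace (k : nat) (V : set torus) : Prop :=
  exists (p : nat) (A : 'M[rat]_(p, n)) (c : 'cV[R]_p),
    let L := [set x : 'cV[R]_n | map_mx ratr A *m x = c] in
    [/\ L !=set0, k = (n - \rank A)%N & V = torus_proj @` L].

(* The dimension of a toric subspace is unique; 0 is the (unused) value on
   sets that are not toric subspaces. *)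
Definition toric_dim (V : set torus) : nat :=
  xget 0%N [set k | toric_subspace k V].

Definition unit_ball : set 'cV[R]_n :=
  [set x | \sum_(i < n) x i 0 ^+ 2 < 1].

End Torus.

Arguments unit_ball : clear implicits.

Definition components (X : topologicalType) (A : set X) : set (set X) :=
  connected_component A @` A.

Definition homeomorphic (X Y : topologicalType) (A : set X) (B : set Y) :=
  exists (f : X -> Y) (g : Y -> X),
    [/\ f @` A `<=` B, g @` B `<=` A,
        (forall x, A x -> g (f x) = x), (forall y, B y -> f (g y) = y) &
        {within A, continuous f} /\ {within B, continuous g}].

Section Mobius.
Context (X : choiceType) (P : set X) (le : X -> X -> Prop).

(* The recursion mu(x, x) = 1, mu(x, y) = - sum_(x <= z < y) mu(x, z).  It goes
   down along chains of P, so that #|P| is enough fuel (see mobiusE). *)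
Fixpoint mobius_rec (k : nat) (x y : X) : int :=
  if k is k'.+1 then
    if x == y then 1
    else - \sum_(z \in [set z | [/\ P z, le x z, le z y & z <> y]])
             mobius_rec k' x z
  else 0.

Definition mobius : X -> X -> int := mobius_rec #|` fset_set P|%fset.

Hypotheses (finP : finite_set P) (le_refl : forall x, le x x)
  (le_anti : forall x y, le x y -> le y x -> x = y)
  (le_trans : forall x y z, le x y -> le y z -> le x z).

Let down (y : X) := fset_set [set z | P z /\ le z y].

Let in_down y z : (z \in down y) = `[< P z /\ le z y >].
Proof.
rewrite in_fset_set; last by apply: sub_finite_set finP => ? [].
by apply/idP/asboolP; rewrite inE.
Qed.

Let down_lt y z : P y -> le z y -> z <> y ->
  (#|` down z| < #|` down y|)%N.
Proof.
move=> Py zy nzy; apply: fproper_ltn_card; rewrite fproperE; apply/andP; split.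
  apply/fsubsetP => w; rewrite !in_down => /asboolP[Pw wz].
  by apply/asboolP; split=> //; exact: le_trans zy.
apply/negP => /fsubsetP /(_ y); rewrite !in_down => yz.
have /asboolP[_ /le_anti] : `[< P y /\ le y z >] by apply/yz/asboolP.
by move=> /(_ zy) /esym.
Qed.

Let mobius_rec_stable k x y : P y -> (#|` down y| <= k)%N ->
  mobius_rec k.+1 x y = mobius_rec k x y.
Proof.
elim: k y => [|k IH] y Py hk.
  have : y \in down y by rewrite in_down; apply/asboolP.
  by move: hk; rewrite leqn0 cardfs_eq0 => /eqP ->; rewrite in_fset0.
rewrite -[LHS]/(if x == y then 1 else - \sum_(z \in _) mobius_rec k.+1 x z).
rewrite -[RHS]/(if x == y then 1 else - \sum_(z \in _) mobius_rec k x z).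
case: ifP => // _; congr (- _); apply: eq_fsbigr => z.
rewrite inE => -[Pz xz zy nzy].
by apply: IH => //; rewrite -ltnS; apply: leq_trans hk; exact: down_lt.
Qed.

Lemma mobiusE x y : P y ->
  mobius x y = if x == y then 1
    else - \sum_(z \in [set z | [/\ P z, le x z, le z y & z <> y]]) mobius x z.
Proof.
move=> Py; rewrite {1}/mobius -mobius_rec_stable //.
apply: fsubset_leq_card; apply/fsubsetP => z; rewrite in_down => /asboolP[Pz _].
by rewrite in_fset_set // inE.
Qed.

End Mobius.

Section Arrangement.
Context (R : realType) (n m : nat) (H : 'I_m -> set (torus R n)).

Definition intersection_poset : set (set (torus R n)) :=
  [set C | C = set0 \/
     exists S : {set 'I_m}, components (\bigcap_(i in [set` S]) H i) C].

Definition rev_incl (x y : set (torus R n)) : Prop := y `<=` x.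

Definition toric_char_poly : {poly int} :=
  \sum_(x \in intersection_poset `\ set0)
    mobius intersection_poset rev_incl setT x *: 'X^(toric_dim x).

Definition regions : set (set (torus R n)) :=
  components (~` \bigcup_i H i).

End Arrangement.

(* Main.v *)
Require Import Defs.
From mathcomp Require Import all_boot all_order all_algebra.
From mathcomp Require Import finmap.
From mathcomp Require Import all_classical all_reals all_analysis.
From mathcomp Require Import lra zify ring.
Import Order.TTheory GRing.Theory Num.Theory.
Import numFieldNormedType.Exports.
Local Open Scope classical_set_scope.
Local Open Scope ring_scope.

Set Implicit Arguments.
Unset Strict Implicit.
Unset Printing Implicit Defensive.

(** Euler characteristic with compact supports. Integrating coordinate by
    coordinate, an integer-valued function on a circle being sent to the sum of
    its jumps [g t - g (t+)], gives an additive functional on tame functions on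
    the torus. It is 1 on a point, 0 on a subtorus of positive dimension (all the
    slices are translates of one another, so that the outer integrand is constant)
    and (-1)^n on the projection of a bounded open convex set (the nonempty slices
    are bounded, open and convex, and lie over an open interval). Moebius inversion
    writes the indicator of the complement of the arrangement as the sum of
    [mu z 1_z] over the strata [z], hence its integral is the characteristic
    polynomial at 0. The complement is also the disjoint union of the regions,
    which are projections of open polyhedra. Such a polyhedron is bounded when its
    region is a ball: otherwise the normals of the hyperplanes do not span, the
    polyhedron is invariant under a nonzero integer translation, and the region
    contains a loop with a nonzero winding number around a coordinate circle. *)

(** * Integration over a circle *)

Section CircleEuler.
Context (R : realType).
Implicit Types (g : R -> int) (t s : R).

(* Only the values of g on the fundamental domain [0, 1) matter. *)
Definition circ_euler g (e : int) : Prop :=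
  exists gp : R -> int,
    [/\ forall t, 0 <= t < 1 ->
          exists2 d : R, 0 < d & forall s, t < s < t + d -> s < 1 -> g s = gp t,
        finite_set [set t : R | 0 <= t < 1 /\ g t <> gp t] &
        e = \sum_(t \in [set t : R | 0 <= t < 1]) (g t - gp t)].

Lemma circ_euler_ext g g' e : (forall t, 0 <= t < 1 -> g t = g' t) ->
  circ_euler g e -> circ_euler g' e.
Proof.
move=> gg' [gp [lim fin ->]]; exists gp; split.
- move=> t t01; have [d d0 dP] := lim t t01; exists d => // s ts s1.
  by rewrite -gg' ?dP//; case/andP: t01; case/andP: ts; lra.
- by apply: sub_finite_set fin => t [t01 /=]; rewrite -gg'.
- by apply: eq_fsbigr => t; rewrite inE /= => /gg' ->.
Qed.

(** Right limits are unique: the two candidates are compared at [t + m / 2], which lies in both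
    right neighbourhoods and still below 1. *)
Lemma circ_euler_unique g e e' : circ_euler g e -> circ_euler g e' -> e = e'.
Proof.
move=> [gp [lim _ ->]] [gp' [lim' _ ->]]; apply: eq_fsbigr => t.
rewrite inE /= => t01; congr (_ - _).
have [d d0 dP] := lim t t01; have [d' d0' dP'] := lim' t t01.
pose m := Num.min (Num.min d d') (1 - t).
have [md [md' mt]] : m <= d /\ m <= d' /\ m <= 1 - t.
  by rewrite /m !ge_min !lexx ?orbT.
have m0 : 0 < m by rewrite !lt_min d0 d0' /=; case/andP: t01; lra.
by rewrite -(dP (t + m / 2)) ?(dP' (t + m / 2)) //; lra.
Qed.

Lemma circ_eulerD g g' e e' : circ_euler g e -> circ_euler g' e' ->
  circ_euler (fun t => g t + g' t) (e + e').
Proof.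
move=> [gp [lim fin ->]] [gp' [lim' fin' ->]].
pose D : set R := [set t : R | 0 <= t < 1 /\ g t <> gp t] `|`
  [set t : R | 0 <= t < 1 /\ g' t <> gp' t].
have finU : finite_set D by rewrite finite_setU.
exists (fun t => gp t + gp' t); split.
- move=> t t01; have [d d0 dP] := lim t t01; have [d' d0' dP'] := lim' t t01.
  exists (Num.min d d'); first by rewrite lt_min d0.
  move=> s /andP[ts]; rewrite -ltrBlDl lt_min => /andP[sd sd'] s1.
  by rewrite dP ?dP' // ts /= -ltrBlDl.
- apply: sub_finite_set finU => t [t01 /= ne].
  have [E|] := eqVneq (g t) (gp t); last by move/eqP; left.
  by right; split=> // E'; apply: ne; rewrite E E'.
- have widen (h : R -> int) : (forall t : R, 0 <= t < 1 -> ~ D t -> h t = 0) ->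
      \sum_(t \in [set t : R | 0 <= t < 1]) h t = \sum_(t \in D) h t.
    move=> h0; apply/esym/fsbig_widen; first by move=> t [[]|[]].
    by move=> t /= [t01 nD]; rewrite h0.
  rewrite !widen -?fsbig_split //=.
  + by apply: eq_fsbigr => t _; rewrite opprD addrACA.
  + move=> t t01 /not_orP[/not_andP[//|/contrapT ->] /not_andP[//|/contrapT ->]].
    by rewrite subrr.
  + by move=> t t01 /not_orP[_ /not_andP[//|/contrapT ->]]; rewrite subrr.
  + by move=> t t01 /not_orP[/not_andP[//|/contrapT ->] _]; rewrite subrr.
Qed.

Lemma circ_eulerM c g e : circ_euler g e -> circ_euler (fun t => c * g t) (c * e).
Proof.
move=> [gp [lim fin ->]]; exists (fun t => c * gp t); split.
- by move=> t t01; have [d d0 dP] := lim t t01; exists d => // s ts s1; rewrite dP.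
- by apply: sub_finite_set fin => t [t01 /= ne]; split=> // E; rewrite E in ne.
- by rewrite mulr_fsumr; apply: eq_fsbigr => t _; rewrite mulrBr.
Qed.

Lemma circ_euler_cst c : circ_euler (fun=> c) 0.
Proof.
exists (fun=> c); split=> //.
- by move=> t _; exists 1.
- by apply: (sub_finite_set _ (finite_set0 _)) => t [].
- by rewrite fsbig1 // => t _; rewrite subrr.
Qed.

(** Covers functions with at most one jump. The point [p] may lie outside the fundamental domain,
    and then contributes nothing. *)
Lemma circ_euler_jump g gp p :
  (forall t, 0 <= t < 1 ->
     exists2 d : R, 0 < d & forall s, t < s < t + d -> s < 1 -> g s = gp t) ->
  (forall t, 0 <= t < 1 -> t <> p -> g t = gp t) ->
  circ_euler g (if 0 <= p < 1 then g p - gp p else 0).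
Proof.
move=> lim off; exists gp; split=> //.
  apply: (sub_finite_set _ (finite_set1 p)) => t [t01 ne] /=.
  by apply: contrapT => /(off _ t01).
case: ifPn => p01.
  rewrite -(fsbig_widen [set p]) ?fsbig_set1 //; first by move=> ? ->.
  by move=> t /= [t01 tp]; rewrite off ?subrr.
rewrite fsbig1 // => t /= t01; rewrite off ?subrr // => tp.
by move: p01; rewrite -tp t01.
Qed.

Lemma circ_euler_point p : 0 <= p < 1 -> circ_euler (fun t => (t == p)%:Z) 1.
Proof.
move=> p01.
have := @circ_euler_jump (fun t => (t == p)%:Z) (fun=> 0) p.
rewrite p01 eqxx subr0; apply; last by move=> t _ /eqP/negPf ->.
move=> t _; have [tp|pt] := ltrP t p.
  exists (p - t); first by rewrite subr_gt0.
  by move=> s sp _; rewrite lt_eqF //; lra.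
by exists 1 => // s sp _; rewrite gt_eqF //; lra.
Qed.

(** Only the left end of an open interval counts: there the value is 0 and the right limit 1, a jump
    of -1, while at the right end both are 0. *)
Lemma circ_euler_itv (a b z : R) : a < b ->
  circ_euler (fun t => (a < t + z < b)%R%:Z) (- (0 <= a - z < 1)%R%:Z).
Proof.
move=> ab.
have := @circ_euler_jump (fun t => (a < t + z < b)%R%:Z)
  (fun t => (a <= t + z < b)%R%:Z) (a - z).
rewrite /= subrK ltxx lexx ab /= sub0r => jump.
have -> : - (0 <= a - z < 1)%R%:Z = if 0 <= a - z < 1 then -1%N%:Z else 0.
  by case: ifP.
apply: jump => [t _|t _ ta]; last first.
  congr (Posz (nat_of_bool _)); rewrite le_eqVlt.
  by case: (eqVneq a) => // E; case: ta; rewrite E addrK.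
have [tb|bt] := ltrP (t + z) b; last first.
  exists 1 => // s /andP[ts _] _; congr (Posz (nat_of_bool _)).
  by rewrite [RHS]andbF; apply/negbTE/negP => /andP[_]; lra.
have [ta|at_] := ltrP (t + z) a.
  exists (a - (t + z)); first lra.
  move=> s /andP[ts sd] _; congr (Posz (nat_of_bool _)).
  by apply/negbTE/negP => /andP[]; lra.
exists (b - (t + z)); first lra.
by move=> s /andP[ts sd] _; congr (Posz (nat_of_bool _)); apply/andP; split; lra.
Qed.

End CircleEuler.

(** * Integration over a torus *)

Section TorusEuler.
Context (R : realType).

Definition ccons n (t : R) (x : 'cV[R]_n) : 'cV[R]_n.+1 :=
  col_mx (const_mx t : 'cV_1) x.

Definition ctail n (x : 'cV[R]_n.+1) : 'cV[R]_n := @dsubmx _ 1 n 1 x.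

Lemma ccons0 n t (x : 'cV[R]_n) : ccons t x 0 0 = t.
Proof.
rewrite /ccons (_ : 0 = lshift n (0 : 'I_1)); last exact/val_inj.
by rewrite (@col_mxEu _ 1 n) mxE.
Qed.

Lemma ctailE n t (x : 'cV[R]_n) : ctail (ccons t x) = x.
Proof. by rewrite /ctail /ccons col_mxKd. Qed.

Lemma cconsE n (x : 'cV[R]_n.+1) : x = ccons (x 0 0) (ctail x).
Proof.
apply: etrans (esym (@vsubmxK _ 1 n 1 x)) _; rewrite /ccons; congr col_mx.
apply/matrixP => i j; rewrite !ord1 !mxE; congr (x _ _); exact/val_inj.
Qed.

Lemma cconsS n t (x : 'cV[R]_n) (i : 'I_n) : ccons t x (rshift 1 i) 0 = x i 0.
Proof. by rewrite /ccons (@col_mxEd _ 1 n). Qed.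

Lemma ccons_inj n t t' (x x' : 'cV[R]_n) :
  ccons t x = ccons t' x' -> t = t' /\ x = x'.
Proof.
move=> E; split; first by rewrite -(ccons0 t x) E ccons0.
by rewrite -(ctailE t x) E ctailE.
Qed.

Lemma cconsD n t t' (x x' : 'cV[R]_n) :
  ccons t x + ccons t' x' = ccons (t + t') (x + x').
Proof.
rewrite /ccons (@add_col_mx _ 1 n); apply: (f_equal2 (@col_mx _ 1 n 1)) => //.
by apply/matrixP => i j; rewrite !mxE.
Qed.

Lemma cconsZ n c t (x : 'cV[R]_n) : c *: ccons t x = ccons (c * t) (c *: x).
Proof.
rewrite /ccons (@scale_col_mx _ 1 n); apply: (f_equal2 (@col_mx _ 1 n 1)) => //.
by apply/matrixP => i j; rewrite !mxE.
Qed.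

Lemma ccons00 n : ccons 0 0 = 0 :> 'cV[R]_n.+1.
Proof. exact: (@col_mx0 _ 1 n 1). Qed.

Definition unit_box n (x : 'cV[R]_n) : Prop := forall i, 0 <= x i 0 < 1.

Lemma unit_box_ccons n t (x : 'cV[R]_n) :
  unit_box (ccons t x) <-> 0 <= t < 1 /\ unit_box x.
Proof.
split=> [b|[t01 b] i].
  by split=> [|i]; [have := b 0; rewrite ccons0 | have := b (rshift 1 i); rewrite cconsS].
case: (@fintype.splitP 1 n i) => j ij.
  by rewrite (_ : i = 0) ?ccons0 //; apply/val_inj; rewrite /= ij; case: j {ij} => -[].
by rewrite (_ : i = rshift 1 j) ?cconsS //; apply/val_inj.
Qed.

(** An iterated integral whose outermost variable is the first coordinate. It is a relation because
    only tame functions have an integral. *)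
Fixpoint euler n : ('cV[R]_n -> int) -> int -> Prop :=
  match n with
  | 0 => fun f e => e = f 0
  | n'.+1 => fun f e => exists2 g : R -> int,
      forall t, 0 <= t < 1 -> euler (fun x : 'cV_n' => f (ccons t x)) (g t) &
      circ_euler g e
  end.

Lemma euler_ext n (f f' : 'cV[R]_n -> int) e :
  (forall x, unit_box x -> f x = f' x) -> euler f e -> euler f' e.
Proof.
elim: n f f' e => [|n IH] f f' e ff' /=.
  by move=> ->; apply: ff' => -[].
move=> [g eg ce]; exists g => // t t01; apply: IH (eg t t01) => x bx.
by apply: ff'; apply/unit_box_ccons.
Qed.

Lemma euler_unique n (f : 'cV[R]_n -> int) e e' :
  euler f e -> euler f e' -> e = e'.
Proof.
elim: n f e e' => [|n IH] f e e' /=; first by move=> -> ->.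
move=> [g eg ce] [g' eg' ce']; apply: circ_euler_unique ce'.
by apply: circ_euler_ext ce => t t01; apply: IH (eg t t01) (eg' t t01).
Qed.

Lemma eulerD n (f f' : 'cV[R]_n -> int) e e' :
  euler f e -> euler f' e' -> euler (fun x => f x + f' x) (e + e').
Proof.
elim: n f f' e e' => [|n IH] f f' e e' /=; first by move=> -> ->.
move=> [g eg ce] [g' eg' ce']; exists (fun t => g t + g' t).
  by move=> t t01; apply: IH; [exact: eg|exact: eg'].
exact: circ_eulerD.
Qed.

Lemma eulerM n c (f : 'cV[R]_n -> int) e :
  euler f e -> euler (fun x => c * f x) (c * e).
Proof.
elim: n f e => [|n IH] f e /=; first by move=> ->.
move=> [g eg ce]; exists (fun t => c * g t); last exact: circ_eulerM.
by move=> t t01; apply: IH; exact: eg.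
Qed.

Lemma euler0 n : euler (fun _ : 'cV[R]_n => 0) 0.
Proof.
elim: n => [//|n IH] /=; exists (fun=> 0) => //; exact: circ_euler_cst.
Qed.

Lemma euler_sum (I : eqType) n (r : seq I) (f : I -> 'cV[R]_n -> int) e :
  (forall i, i \in r -> euler (f i) (e i)) ->
  euler (fun x => \sum_(i <- r) f i x) (\sum_(i <- r) e i).
Proof.
elim: r => [_|i r IH fe].
  by rewrite big_nil; apply: euler_ext (euler0 n) => x _; rewrite big_nil.
rewrite big_cons; have := eulerD (fe i (mem_head _ _)) (IH _).
move=> E; apply: euler_ext (E _) => [x _|j jr]; first by rewrite big_cons.
by apply: fe; rewrite inE jr orbT.
Qed.

Lemma euler_point n (p : 'cV[R]_n) : unit_box p ->
  euler (fun x => (x == p)%:Z) 1.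
Proof.
elim: n p => [|n IH] p bp /=; first by rewrite (flatmx0 p) eqxx.
move: bp; rewrite (cconsE p) => /unit_box_ccons[p0 bp].
exists (fun t => (t == p 0 0)%:Z); last exact: circ_euler_point.
move=> t t01; have [->|tp] := eqVneq t (p 0 0).
  apply: euler_ext (IH _ bp) => x _; congr (Posz (nat_of_bool _)).
  by apply/eqP/eqP => [->//|/ccons_inj[]].
apply: euler_ext (euler0 n) => x _.
by case: eqP => // /ccons_inj[/eqP]; rewrite (negPf tp).
Qed.

Definition intv n (z : 'cV[int]_n) : 'cV[R]_n := map_mx intr z.

Lemma intvD n (z z' : 'cV[int]_n) : intv (z + z') = intv z + intv z'.
Proof. exact: map_mxD. Qed.

Lemma intvN n (z : 'cV[int]_n) : intv (- z) = - intv z.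
Proof. exact: map_mxN. Qed.

Lemma intv_inj n : injective (@intv n).
Proof.
move=> z z' E; apply/matrixP => i j; move/matrixP/(_ i j): E.
by rewrite !mxE => /intr_inj.
Qed.

Lemma intv_mul p n (a : 'M[int]_(p, n)) (z : 'cV[int]_n) :
  map_mx intr a *m intv z = intv (a *m z).
Proof. by rewrite /intv map_mxM. Qed.

Lemma ccons_intv n (z : int) (x : 'cV[int]_n) :
  ccons z%:~R (intv x) = intv (col_mx (const_mx z : 'cV_1) x).
Proof.
rewrite /ccons /intv (@map_col_mx _ _ _ 1 n); apply: (f_equal2 (@col_mx _ 1 n 1)) => //.
by apply/matrixP => i j; rewrite !mxE.
Qed.

Lemma intv_ccons n (z : 'cV[int]_n.+1) :
  intv z = ccons (z 0 0)%:~R (intv (@dsubmx _ 1 n 1 z)).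
Proof.
rewrite [LHS]cconsE mxE; congr ccons.
by apply/matrixP => i j; rewrite !mxE.
Qed.

Definition fracv n (x : 'cV[R]_n) : 'cV[R]_n := x - intv (map_mx Num.floor x).

Lemma fracv_box n (x : 'cV[R]_n) : unit_box (fracv x).
Proof.
move=> i; rewrite /fracv !mxE; have := floor_itv (x i 0).
by rewrite intrD; lra.
Qed.

Lemma unit_box_eq n (x y : 'cV[R]_n) (z : 'cV[int]_n) :
  unit_box x -> unit_box y -> x = y + intv z -> x = y.
Proof.
move=> bx b_y E; suff z0 : z = 0 by rewrite E z0 /intv map_mx0 addr0.
apply/matrixP => i j; rewrite (ord1 j) [RHS]mxE.
have := congr1 (fun M : 'cV_n => M i 0) E; rewrite !mxE => Ei.
have zE : (z i 0)%:~R = x i 0 - y i 0 by rewrite Ei addrAC subrr add0r.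
have := bx i; have := b_y i => /andP[y0 y1] /andP[x0 x1].
have z1 : (z i 0)%:~R < 1%:~R :> R by rewrite zE; lra.
have z2 : (-1)%:~R < (z i 0)%:~R :> R by rewrite zE rmorphN /=; lra.
by move: z1 z2; rewrite !ltr_int; lia.
Qed.

End TorusEuler.

(** * Projections of convex sets *)

Section Periodize.
Context (R : realType).

Definition segment_convex n (U : set 'cV[R]_n) : Prop :=
  forall x y s, U x -> U y -> 0 <= s <= 1 -> U (s *: x + (1 - s) *: y).

(** Openness along lines only: it passes to slices at once and still makes the set of nonempty
    slices open. *)
Definition line_open n (U : set 'cV[R]_n) : Prop :=
  forall x v, U x -> exists2 d : R, 0 < d & forall s, `|s| < d -> U (x + s *: v).

Definition slice n (U : set 'cV[R]_n.+1) (t : R) : set 'cV[R]_n :=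
  [set x | U (ccons t x)].

Lemma segment_convex_slice n (U : set 'cV[R]_n.+1) t :
  segment_convex U -> segment_convex (slice U t).
Proof.
move=> cU x y s Ux Uy s01; have := cU _ _ s Ux Uy s01.
by rewrite !cconsZ cconsD -mulrDl subrKC mul1r.
Qed.

Lemma line_open_slice n (U : set 'cV[R]_n.+1) t :
  line_open U -> line_open (slice U t).
Proof.
move=> oU x v Ux; have [d d0 dP] := oU _ (ccons 0 v) Ux.
by exists d => // s sd; have := dP s sd; rewrite cconsZ cconsD mulr0 addr0.
Qed.

(** The ends are [inf I] and [sup I]: openness keeps them out of [I], and convexity fills in
    everything between them. *)
Lemma open_interval (I : set R) (M : R) :
  I !=set0 ->
  (forall x y s, I x -> I y -> 0 <= s <= 1 -> I (s * x + (1 - s) * y)) ->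
  (forall x, I x -> exists2 d : R, 0 < d & forall s, `|s| < d -> I (x + s)) ->
  (forall x, I x -> `|x| < M) ->
  exists a b, [/\ a < b, - M <= a < M & forall s, I s <-> a < s < b].
Proof.
move=> [x0 Ix0] cI oI bI.
have lbI : has_inf I.
  by split; [exists x0|exists (- M) => x /bI; rewrite ltr_norml; lra].
have ubI : has_sup I.
  by split; [exists x0|exists M => x /bI; rewrite ltr_norml; lra].
have sub s : I s -> inf I < s < sup I.
  move=> Is; have [d d0 dP] := oI s Is.
  have d2 : `|d / 2| < d by rewrite ger0_norm; lra.
  have Nd2 : `|- (d / 2)| < d by rewrite normrN.
  have /(ge_inf lbI.2) lo := dP _ Nd2.
  have /(ub_le_sup ubI.2) hi := dP _ d2.
  by apply/andP; split; lra.
have x0P := sub x0 Ix0.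
exists (inf I), (sup I); split; first by lra.
  apply/andP; split; last by have := bI _ Ix0; rewrite ltr_norml; lra.
  apply: lb_le_inf; first by exists x0.
  by move=> x /bI; rewrite ltr_norml; lra.
move=> s; split=> [/sub //|/andP[s1 s2]].
have [x Ix xs] : exists2 x, I x & x < s.
  have := @inf_adherent _ I (s - inf I); rewrite subr_gt0 subrKC.
  by move=> /(_ s1 lbI).
have [y Iy sy] : exists2 y, I y & s < y.
  have := @sup_adherent _ I (sup I - s); rewrite subr_gt0.
  by move=> /(_ s2 ubI); rewrite subKr.
have yx : y - x != 0 by rewrite gt_eqF //; lra.
have -> : s = ((y - s) / (y - x)) * x + (1 - (y - s) / (y - x)) * y by field.
apply: cI => //; apply/andP; split; first by apply: divr_ge0; lra.
by rewrite ler_pdivrMr; lra.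
Qed.

(* The multiplicity function of the projection of U to the torus: for U inside
   the cube of half-side M and x in the unit box, it is the number of integer
   vectors z such that x + z is in U. *)
Fixpoint periodize (M : nat) n : set 'cV[R]_n -> 'cV[R]_n -> int :=
  match n with
  | 0 => fun U x => `[< U x >]%:Z
  | n'.+1 => fun U x => \sum_(i < M.*2)
      periodize M (slice U (x 0 0 + (i%:R - M%:R))) (ctail x)
  end.

(** The [2 M] windows [[i - M, i - M + 1)] tile [[-M, M)], so exactly one of them contains [a], the
    one with [i = floor (a + M)]. *)
Lemma sum_unit_window (M : nat) (a : R) : - M%:R <= a < M%:R ->
  \sum_(i < M.*2) (0 <= a - (i%:R - M%:R) < 1)%R%:Z = 1.
Proof.
move=> aM; have := floor_itv (a + M%:R); set k := Num.floor _ => ak.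
have k0 : 0 <= k by rewrite floor_ge0; lra.
have kM : k < M.*2%:Z.
  by rewrite -(ltr_int R) -addnn PoszD intrD; rewrite intrD in ak; lra.
have k' : (`|k| < M.*2)%N by lia.
have kE : k = `|k|%N by lia.
rewrite (bigD1 (Ordinal k')) //= big1 ?addr0.
  by rewrite kE intrD in ak; apply/eqP; rewrite eqz_nat eqb1; lra.
move=> i /eqP ne; apply/eqP; rewrite eqz_nat eqb0; apply/negP => iP.
case: ne; apply: val_inj => /=; apply/eqP; rewrite -eqz_nat -kE eq_sym; apply/eqP.
by apply: floor_def; rewrite intrD -pmulrn; lra.
Qed.

(** Induction on the dimension. Every nonempty slice integrates to [(-1) ^ n], and the nonempty
    slices lie over an open interval [(a, b)]. Among its integer translates exactly one has its left
    end in [0, 1), which yields the extra factor -1. *)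
Lemma euler_periodize (M : nat) n (U : set 'cV[R]_n) :
  segment_convex U -> line_open U ->
  (forall x i, U x -> `|x i 0| < M%:R) ->
  euler (periodize M U) (if `[< U !=set0 >] then (-1) ^+ n else 0).
Proof.
elim: n U => [|n IH] U cU oU bU.
  rewrite /= expr0; case: (asboolP (U !=set0)) => [[x Ux]|U0].
    by move: Ux; rewrite (flatmx0 x) => Ux; rewrite asboolT.
  by rewrite asboolF // => Ux; apply: U0; exists 0.
(* The inner integral at [t], by the induction hypothesis applied to every slice over an integer
   translate of [t]. *)
pose g (t : R) : int := \sum_(i < M.*2)
  (if `[< slice U (t + (i%:R - M%:R)) !=set0 >] then (-1) ^+ n else 0).
exists g.
  move=> t t01.
  apply: (@euler_ext _ _ (fun x => \sum_(i < M.*2)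
    periodize M (slice U (t + (i%:R - M%:R))) x)).
    by move=> x _; apply: eq_bigr => i _; rewrite ctailE ccons0.
  apply: euler_sum => i _; apply: IH.
  - exact: segment_convex_slice.
  - exact: line_open_slice.
  - by move=> x j Ux; have := bU _ (rshift 1 j) Ux; rewrite cconsS.
have [U0|U0] := asboolP (U !=set0); last first.
  apply: circ_euler_ext (circ_euler_cst _ 0) => t _; rewrite /g big1 // => i _.
  by rewrite asboolF // => -[x Ux]; apply: U0; exists (ccons (t + (i%:R - M%:R)) x).
have [||||a [b [ab aM abP]]] := @open_interval [set t | slice U t !=set0] M%:R.
- by have [x Ux] := U0; exists (x 0 0), (ctail x); rewrite /slice /= -cconsE.
- move=> x y s [x' Ux] [y' Uy] s01; exists (s *: x' + (1 - s) *: y').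
  by rewrite /slice /= -cconsD -!cconsZ; exact: cU.
- move=> x [x' Ux]; have [d d0 dP] := oU _ (ccons 1 0) Ux.
  exists d => // s sd; exists x'; have := dP s sd.
  by rewrite cconsZ cconsD mulr1 scaler0 addr0.
- by move=> x [x' Ux]; have := bU _ 0 Ux; rewrite ccons0.
apply: (@circ_euler_ext _ (fun t => (-1) ^+ n *
    \sum_(i < M.*2) (a < t + (i%:R - M%:R) < b)%R%:Z)).
  move=> t t01; rewrite /g big_distrr /=; apply: eq_bigr => i _.
  case: (boolP (a < _ < b)) => [/abP|] ti; first by rewrite asboolT // mulr1.
  by rewrite asboolF ?mulr0 // => /abP; rewrite (negPf ti).
have -> : (-1) ^+ n.+1 = (-1) ^+ n *
    \sum_(i < M.*2) - (0 <= a - (i%:R - M%:R) < 1)%R%:Z :> int.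
  by rewrite sumrN sum_unit_window // exprSr.
apply: circ_eulerM.
elim: (index_enum _) => [|i r IHr].
  rewrite big_nil; apply: circ_euler_ext (circ_euler_cst _ 0) => t _.
  by rewrite big_nil.
rewrite big_cons.
have := circ_eulerD (circ_euler_itv (i%:R - M%:R) ab) IHr.
by apply: circ_euler_ext => t _; rewrite big_cons.
Qed.

(** When at most one integer translate of [x] lies in [U], the multiplicity is 0 or 1, hence equal
    to the indicator of the projection. *)
Lemma periodizeE (M : nat) n (U : set 'cV[R]_n) (x : 'cV[R]_n) :
  unit_box x ->
  (forall y i, U y -> `|y i 0| < M%:R) ->
  (forall z z', U (x + intv R z) -> U (x + intv R z') -> z = z') ->
  periodize M U x = `[< exists z, U (x + intv R z) >]%:Z.
Proof.
elim: n U x => [|n IH] U x bx bU dU.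
  rewrite /=; congr (Posz (nat_of_bool _)); apply/asbool_equiv_eq.
  have E (y : 'cV[R]_0) : y = x by rewrite (flatmx0 y) (flatmx0 x).
  by split=> [Ux|[z]]; [exists 0|]; rewrite (E (x + _)).
move: bx bU dU; rewrite (cconsE x); move: (x 0 0) (ctail x) => t y.
move=> /unit_box_ccons[t01 b_y] bU dU; rewrite /= ccons0 ctailE.
pose V i := slice U (t + (i%:R - M%:R)).
have cE (i : nat) z : ccons t y +
    intv R (col_mx (const_mx (i%:Z - M%:Z) : 'cV_1) z) =
    ccons (t + (i%:R - M%:R)) (y + intv R z).
  by rewrite -ccons_intv cconsD intrB.
have pE i : periodize M (V i) y = `[< exists z, V i (y + intv R z) >]%:Z.
  apply: IH => //.
    by move=> v j Uv; have := bU _ (rshift 1 j) Uv; rewrite cconsS.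
  move=> z z'; rewrite /V /slice /= -!cE => Uz Uz'.
  by have := dU _ _ Uz Uz'; case/(@eq_col_mx _ 1 n).
rewrite (eq_bigr (fun i : 'I_M.*2 => `[< exists z, V i (y + intv R z) >]%:Z)) => [|i _];
  last exact: pE.
case: (asboolP (exists z, U (ccons t y + intv R z))) => [[z Uz]|nU]; last first.
  rewrite big1 // => i _; rewrite asboolF // => -[z].
  by rewrite /V /slice /= -cE => Uz; apply: nU; eexists; exact: Uz.
have zM : `|t + (z 0 0)%:~R| < M%:R.
  by have := bU _ 0 Uz; rewrite intv_ccons cconsD ccons0.
have zM1 : - M%:Z <= z 0 0.
  by rewrite -ltzD1 -(ltr_int R) intrD intrN -pmulrn; move: zM; rewrite ltr_norml; lra.
have zM2 : z 0 0 < M%:Z.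
  by rewrite -(ltr_int R) -pmulrn; move: zM; rewrite ltr_norml; lra.
(* Index [i] of the sum stands for the integer [i - M], so the only nonzero term is the one of index
   [z 0 0 + M]. *)
have k' : (`|(z 0 0 + M%:Z)%R| < M.*2)%N by rewrite -addnn; lia.
have zE : z 0 0 = `|(z 0 0 + M%:Z)%R|%N%:Z - M%:Z by lia.
rewrite (bigD1 (Ordinal k')) //= big1 ?addr0.
  rewrite asboolT //; exists (@dsubmx _ 1 n 1 z).
  rewrite /V /slice /= -cE -zE; move: Uz; congr U; congr (_ + intv R _).
  apply: etrans (esym (@vsubmxK _ 1 n 1 z)) _; congr col_mx.
  apply/matrixP => i j; rewrite !ord1 !mxE; congr (z _ _); exact/val_inj.
move=> i /eqP ne; rewrite asboolF // => -[z'].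
rewrite /V /slice /= -cE => Uz'; case: ne; apply: val_inj => /=.
have := dU _ _ Uz Uz' => /(congr1 (fun w : 'cV[int]_n.+1 => w 0 0)).
rewrite [RHS](_ : _ = i%:Z - M%:Z); last first.
  rewrite (_ : 0 = lshift n (0 : 'I_1)); last exact/val_inj.
  by rewrite (@col_mxEu _ 1 n) mxE.
by lia.
Qed.

End Periodize.

(** * Subtori *)

Section LatticePoints.
Context (R : realType).
Local Notation rmx := (map_mx (intr : int -> R)).

Lemma finite_int_box p (N : nat) :
  finite_set [set k : 'cV[int]_p | forall i, `|k i 0| <= N%:Z].
Proof.
pose f (k : 'cV['I_N.*2.+1]_p) : 'cV[int]_p :=
  map_mx (fun i : 'I_N.*2.+1 => i%:Z - N%:Z) k.
have fT : finite_set (f @` [set: 'cV['I_N.*2.+1]_p]).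
  exact/finite_image/finite_finset.
apply: sub_finite_set fT => k kN.
exists (map_mx (fun z : int => inord `|(z + N%:Z)%R|%N) k) => //.
apply/matrixP => i j; rewrite !mxE (ord1 j); have := kN i => /= kNi.
by rewrite inordK; lia.
Qed.

(** The source of all finiteness statements: affine forms are bounded on the unit box, so their
    integer parts take finitely many values there. *)
Lemma label_bounded p n (A : 'M[R]_(p, n)) (b : 'cV[R]_p) :
  exists N : nat, forall x, unit_box x ->
    forall i, `|map_mx Num.floor (A *m x - b) i 0| <= N%:Z.
Proof.
pose B := \sum_i (`|b i 0| + \sum_j `|A i j|).
have B0 i : `|b i 0| + \sum_j `|A i j| <= B.
  rewrite /B (bigD1 i) //= lerDl; apply: sumr_ge0 => k _.
  by rewrite addr_ge0 // sumr_ge0.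
(* The margin of 2 absorbs the truncation of [B] and the rounding down of the form. *)
exists (Num.truncn B).+2 => x bx i; rewrite !mxE.
set s := \sum_j _.
have sB : `|s| <= \sum_j `|A i j|.
  apply: le_trans (ler_norm_sum _ _ _) _; apply: ler_sum => j _.
  have /andP[x0 x1] := bx j.
  by rewrite normrM (ger0_norm x0) ler_piMr // ltW.
have := B0 i; have := truncnS_gt B; have := floor_itv (s - b i 0).
set k := Num.floor _; set T := Num.truncn B.
rewrite intrD => /andP[k1 k2] TB Bi.
have nb : `|s - b i 0| <= B.
  by apply: le_trans (ler_normB _ _) _; apply: le_trans Bi; rewrite addrC lerD2l.
move: nb; rewrite ler_norml => /andP[nb1 nb2].
have kT : k%:~R < T.+1%:Z%:~R :> R by rewrite -pmulrn; lra.
have kT' : - T.+1%:Z%:~R < k%:~R + 1 :> R by rewrite -pmulrn; lra.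
have {}kT : k < T.+1 by rewrite -(ltr_int R).
have {}kT' : - T.+1%:Z < k + 1 by rewrite -(ltr_int R) intrN intrD.
by lia.
Qed.

(** By injectivity a point is determined by its integer label [k], and the labels met in the unit
    box are bounded. *)
Lemma finite_lattice_points p n (A : 'M[R]_(p, n)) (b : 'cV[R]_p)
    (K : set 'cV[R]_p) :
  (forall x : 'cV_n, A *m x = 0 -> x = 0) ->
  (forall y, K y -> exists k, y = b + intv R k) ->
  finite_set [set x | unit_box x /\ K (A *m x)].
Proof.
move=> injA Kb; have [N NP] := label_bounded A b.
pose h k := xget 0 [set x | A *m x = b + intv R k].
apply: (sub_finite_set _ (finite_image h (finite_int_box p N))) => x [bx Kx].
have [k kE] := Kb _ Kx; exists k.
  move=> i; have := NP x bx i; rewrite kE addrAC subrr add0r.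
  by rewrite !mxE intrKfloor.
rewrite /h; case: xgetP => [y -> /= yE|/(_ x)]; last by rewrite /= kE.
by apply/eqP; rewrite -subr_eq0; apply/eqP/injA; rewrite mulmxBr yE kE subrr.
Qed.

Lemma mul_ccons p n (a : 'M[int]_(p, n.+1)) t (x : 'cV[R]_n) :
  rmx a *m ccons t x = t *: rmx (@lsubmx _ p 1 n a) + rmx (@rsubmx _ p 1 n a) *m x.
Proof.
have aE : rmx a = row_mx (rmx (@lsubmx _ p 1 n a)) (rmx (@rsubmx _ p 1 n a)).
  by rewrite -map_row_mx hsubmxK.
rewrite {1}aE (@mul_row_col _ p 1 n 1); congr (_ + _).
apply/matrixP => i j; rewrite (ord1 j) !mxE big_ord_recl big_ord0 !mxE addr0.
by rewrite mulrC.
Qed.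

(** The invariance of [K] makes the integrand periodic, and the kernel vector makes its support
    positive-dimensional where nonempty. Induction on the first coordinate: either the slices still
    have a kernel and integrate to 0, or they are finite and translates of one another, so that
    their cardinality is a constant, with integral 0 on the circle. *)
Lemma euler_subtorus p n (a : 'M[int]_(p, n)) (b : 'cV[R]_p) (K : set 'cV[R]_p) :
  (forall y, K y -> exists k, y = b + intv R k) ->
  (forall y z, K y -> K (y + intv R (a *m z))) ->
  (exists2 x : 'cV_n, x != 0 & rmx a *m x = 0) ->
  euler (fun x => `[< K (rmx a *m x) >]%:Z) 0.
Proof.
elim: n a b K => [|n IH] a b K Kb Ka [x x0 ax0].
  by move: x0; rewrite (flatmx0 x) eqxx.
pose a1 := @lsubmx _ p 1 n a; pose a' := @rsubmx _ p 1 n a.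
have Ka' y z : K y -> K (y + intv R (a' *m z)).
  move=> /(Ka _ (col_mx (const_mx 0 : 'cV_1) z)); congr (K (_ + intv R _)).
  rewrite -[in LHS](@hsubmxK _ p 1 n a) (@mul_row_col _ p 1 n 1).
  by rewrite (_ : const_mx 0 = 0) // mulmx0 add0r.
pose Kt t := [set y | K (t *: rmx a1 + y)].
have KtE t (y : 'cV_n) : K (rmx a *m ccons t y) = Kt t (rmx a' *m y).
  by rewrite mul_ccons.
have Ktb t y : Kt t y -> exists k, y = (b - t *: rmx a1) + intv R k.
  by move=> /Kb[k kE]; exists k; rewrite -addrAC -kE addrC addKr.
have Kta t y z : Kt t y -> Kt t (y + intv R (a' *m z)).
  by rewrite /Kt /= addrA; exact: Ka'.
have [[y y0 ay0]|inj] := pselect (exists2 y : 'cV_n, y != 0 & rmx a' *m y = 0).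
  exists (fun=> 0); last exact: circ_euler_cst.
  move=> t _; have := IH a' _ _ (Ktb t) (Kta t) (ex_intro2 _ _ y y0 ay0).
  by apply: euler_ext => u _; rewrite KtE.
have {}inj (y : 'cV_n) : rmx a' *m y = 0 -> y = 0.
  by move=> ay0; apply/eqP; apply: contra_notT inj => y0; exists y.
(* A kernel vector [(t, y)] has [t != 0] since [a'] is injective; hence the first column of [a] is
   [a' q] with [q = - y / t]. *)
have [q qE] : exists q : 'cV_n, rmx a1 = rmx a' *m q.
  move: x0 ax0; rewrite (cconsE x) mul_ccons -/a1 -/a'.
  move: (x 0 0) (ctail x) => t y x0 E.
  have t0 : t != 0.
    apply: contraNneq x0 => t0; move: E; rewrite t0 scale0r add0r => /inj ->.
    by rewrite ccons00.
  exists (- t^-1 *: y); rewrite -scalemxAr scaleNr.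
  have -> : rmx a' *m y = - (t *: rmx a1) by apply/eqP; rewrite -addr_eq0 addrC E.
  by rewrite scalerN opprK scalerA mulVf // scale1r.
(* The slice at 0, a finite set [F]. The slice at [t] will be its translate by [- t q], brought back
   to the unit box. *)
have fin := @finite_lattice_points _ _ (rmx a') _ _ inj (Ktb 0).
set F := [set _ | _] in fin.
have Kfrac u z : K (rmx a' *m u) -> K (rmx a' *m (u + intv R z)).
  by rewrite mulmxDr intv_mul; exact: Ka'.
exists (fun=> \sum_(u <- fset_set F) 1); last exact: circ_euler_cst.
move=> t t01.
apply: (@euler_ext _ _ (fun x => \sum_(u <- fset_set F) (x == fracv (u - t *: q))%:Z)).
  move=> y b_y; rewrite KtE /Kt /= qE scalemxAr -mulmxDr.
  have [Ky|nKy] := asboolP (K _).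
    pose u0 := fracv (t *: q + y).
    have u0E : u0 = t *: q + y + intv R (- map_mx Num.floor (t *: q + y)).
      by rewrite intvN.
    have u0F : u0 \in fset_set F.
      rewrite in_fset_set // inE /F; split; first exact: fracv_box.
      by rewrite /Kt /= scale0r add0r u0E; exact: Kfrac.
    (* Translation by [t q] inverts translation by [- t q] modulo the lattice, so [u0] is the only
       point of the box sent to [y]. *)
    have key u : unit_box u -> (y == fracv (u - t *: q)) = (u == u0).
      move=> bu; apply/eqP/eqP => [yE|->].
        apply: (@unit_box_eq _ _ _ _ (map_mx Num.floor (u - t *: q) +
          map_mx Num.floor (t *: q + y))) => //; first exact: fracv_box.
        rewrite u0E intvN intvD {1}yE /fracv.
        set A := intv R _; set B := intv R _; move: A B => A B.
        by apply/matrixP => i j; rewrite !mxE; ring.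
      apply: (@unit_box_eq _ _ _ _ (map_mx Num.floor (u0 - t *: q) +
          map_mx Num.floor (t *: q + y))) => //; first exact: fracv_box.
      rewrite /fracv intvD u0E intvN.
      set A := intv R _; set B := intv R _; move: A B => A B.
      by apply/matrixP => i j; rewrite !mxE; ring.
    rewrite (big_rem u0) //= key ?eqxx; last exact: fracv_box.
    rewrite big_seq big1 ?addr0 // => u; rewrite mem_rem_uniq ?fset_uniq // inE.
    move=> /andP[uu0]; rewrite in_fset_set // inE => -[bu _].
    by rewrite key // (negPf uu0).
  rewrite big_seq big1 // => u; rewrite in_fset_set // inE => -[bu].
  rewrite /Kt /= scale0r add0r => Ku; case: eqP => // yE; case: nKy.
  have -> : t *: q + y = u + intv R (- map_mx Num.floor (u - t *: q)).
    rewrite yE /fracv intvN; set A := intv R _.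
    by apply/matrixP => i j; rewrite !mxE; ring.
  exact: Kfrac.
by apply: euler_sum => u _; apply: euler_point; exact: fracv_box.
Qed.

End LatticePoints.

(** * Winding numbers *)

Section Winding.
Context (R : realType).
Implicit Types x y : R.

(** The representative of [y] modulo 1 in [[-1/2, 1/2)]; its absolute value is the distance from [y]
    to the nearest integer. *)
Definition cfrac y : R := y - (Num.floor (y + 2^-1))%:~R.

Lemma cfrac_int y : exists k : int, cfrac y = y - k%:~R.
Proof. by eexists. Qed.

Lemma cfracD y (k : int) : cfrac (y + k%:~R) = cfrac y.
Proof.
rewrite /cfrac [y + _ + 2^-1]addrAC floorDrz ?intr_int // intrD intrKfloor.
by rewrite opprD addrACA subrr addr0.
Qed.

Lemma cfrac_id y : `|y| < 2^-1 -> cfrac y = y.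
Proof.
rewrite ltr_norml => y2; rewrite /cfrac (_ : Num.floor _ = 0) ?subr0 //.
by apply: floor_def; rewrite add0r; lra.
Qed.

Lemma cfrac0 : cfrac 0 = 0.
Proof. by rewrite cfrac_id // normr0; lra. Qed.

Lemma cfrac_le y (k : int) : `|cfrac y| <= `|y - k%:~R|.
Proof.
have := floor_itv (y + 2^-1); rewrite /cfrac; set f := Num.floor _ => fy.
have [->//|fk] := eqVneq f k.
have : `|(f - k)%:~R| >= 1 :> R.
  by rewrite -intr_norm -[1]/(1%:~R) ler_int; lia.
rewrite intrD in fy; rewrite intrB ler_normr => fk1; rewrite ler_norml.
case: (lerP 0 (y - k%:~R)) => h; [rewrite (ger0_norm h)|rewrite (ltr0_norm h)];
  case/orP: fk1 => fk1; apply/andP; split; lra.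
Qed.

Lemma cfrac_norm_le y : `|cfrac y| <= `|y|.
Proof. by have := cfrac_le y 0; rewrite subr0. Qed.

Lemma cfrac_normD y y' : `|cfrac (y + y')| <= `|cfrac y| + `|cfrac y'|.
Proof.
have [k ->] := cfrac_int y; have [k' ->] := cfrac_int y'.
apply: le_trans (cfrac_le _ (k + k')) (le_trans _ (ler_normD _ _)).
by rewrite intrD opprD addrACA.
Qed.

Lemma cfrac_normB y y' : `|cfrac (y - y')| = `|cfrac (y' - y)|.
Proof.
suff le a b : `|cfrac (a - b)| <= `|cfrac (b - a)| by apply/eqP; rewrite eq_le !le.
have [k ->] := cfrac_int (b - a); apply: le_trans (cfrac_le _ (- k)) _.
by rewrite -normrN intrN opprD !opprK opprB addrC [- k%:~R + _]addrC addrC.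
Qed.

Lemma small_int (k : int) : `|k%:~R| < 1 :> R -> k = 0.
Proof. by rewrite -intr_norm -[1]/(1%:~R) ltr_int; lia. Qed.

(** Uniform continuity modulo 1 on the compact unit square. Two points near a common centre differ
    by less than [1/8 + 1/8]. *)
Lemma uniform_grid (phi : R -> R -> R) :
  (forall p : R * R, \forall q \near p,
     `|cfrac (phi q.1 q.2 - phi p.1 p.2)| < 8^-1) ->
  \forall N \near \oo, forall u t u' t' : R,
    0 <= u <= 1 -> 0 <= t <= 1 ->
    `|u' - u| <= N.+1%:R^-1 -> `|t' - t| <= N.+1%:R^-1 ->
    `|cfrac (phi u' t' - phi u t)| < 4^-1.
Proof.
move=> loc.
have cK : compact (`[0, 1]%classic `*` `[0, 1]%classic : set (R * R)).
  by apply: compact_setX; exact: segment_compact.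
have /compact_near_coveringP cov := cK.
have := cov nat \oo (fun N (p : R * R) => forall u' t',
    `|u' - p.1| <= N.+1%:R^-1 -> `|t' - p.2| <= N.+1%:R^-1 ->
    `|cfrac (phi u' t' - phi p.1 p.2)| < 4^-1) _.
have H : forall p : R * R, (`[0, 1]%classic `*` `[0, 1]%classic) p ->
  \forall p' \near p & N \near \oo, forall u' t',
    `|u' - p'.1| <= N.+1%:R^-1 -> `|t' - p'.2| <= N.+1%:R^-1 ->
    `|cfrac (phi u' t' - phi p'.1 p'.2)| < 4^-1.
  move=> p _; have /nbhs_ballP[e /= e0 eP] := loc p.
  have e2 : 0 < e / 2 by rewrite divr_gt0.
  exists (ball p (e / 2), [set N | N.+1%:R^-1 < e / 2]) => /=.
    split; first by exact: nbhsx_ballx.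
    exact: (near_infty_natSinv_lt (PosNum e2)).
  move=> [p' N] /= [[p1 p2] Ne] u' t' u1 t1.
  move: p1 p2; rewrite /ball /= => p1 p2.
  have A : `|cfrac (phi p'.1 p'.2 - phi p.1 p.2)| < 8^-1.
    by apply: eP; split => /=; rewrite /ball /=; lra.
  have B : `|cfrac (phi u' t' - phi p.1 p.2)| < 8^-1.
    apply: (eP (u', t')); split => /=; rewrite /ball /= distrC.
      rewrite -(subrKA p'.1); apply: le_lt_trans (ler_normD _ _) _.
      by rewrite (distrC _ p.1) [e]splitr ltrD // (le_lt_trans u1).
    rewrite -(subrKA p'.2); apply: le_lt_trans (ler_normD _ _) _.
    by rewrite (distrC _ p.2) [e]splitr ltrD // (le_lt_trans t1).
  rewrite -(subrKA (phi p.1 p.2)); apply: le_lt_trans (cfrac_normD _ _) _.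
  by rewrite (cfrac_normB (phi p.1 p.2)); lra.
move=> /(_ _ H); apply: filterS => N NP u t u' t' u01 t01.
by apply: (NP (u, t)); split; rewrite /= in_itv.
Qed.

(** [phi] lifts, up to integers, a homotopy from a loop of degree [d] to a constant loop. On a fine
    grid, the sum [W j] of the small increments along row [j] is the winding number; it does not
    depend on [j], equals [d] on the first row and 0 on the last. *)
Lemma winding_number0 (phi : R -> R -> R) (d : int) :
  (forall p : R * R, \forall q \near p,
     `|cfrac (phi q.1 q.2 - phi p.1 p.2)| < 8^-1) ->
  (forall u, phi u 0 = phi u 1) ->
  (forall t, phi 1 t = phi 1 0) ->
  (forall t, exists k : int, phi 0 t = phi 0 0 + t * d%:~R + k%:~R) ->
  d = 0.
Proof.
move=> loc closed cst lin.
have gN := uniform_grid loc.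
(* The bound [2 |d| < N] keeps the increments [d / (N + 1)] of the linear row below 1/2, where
   [cfrac] is the identity. *)
have [N [grid Nd]] : exists N : nat,
   (forall u t u' t' : R, 0 <= u <= 1 -> 0 <= t <= 1 ->
    `|u' - u| <= N.+1%:R^-1 -> `|t' - t| <= N.+1%:R^-1 ->
    `|cfrac (phi u' t' - phi u t)| < 4^-1) /\ (2 * `|d| < N)%N.
  have [N []] := filter_ex (filterI gN (nbhs_infty_gt (2 * `|d|)%N)).
  by exists N; split.
pose h : R := N.+1%:R^-1.
have h0 : 0 < h by rewrite invr_gt0.
have hN : N.+1%:R * h = 1 by rewrite divff.
pose P (j k : nat) := phi (j%:R * h) (k%:R * h).
have in01 j : (j <= N.+1)%N -> 0 <= j%:R * h <= 1.
  move=> jN; rewrite mulr_ge0 ?(ltW h0) //= -[leRHS]hN ler_pM2r // ler_nat //.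
have step j : `|j.+1%:R * h - j%:R * h| <= h.
  by rewrite -mulrBl -natrB // subSnn mul1r ger0_norm // ltW.
have stay j : `|j%:R * h - j%:R * h| <= h by rewrite subrr normr0 ltW.
pose X j k := cfrac (P j k.+1 - P j k).
pose Y j k := cfrac (P j.+1 k - P j k).
have Xs j k : (j <= N.+1)%N -> (k <= N.+1)%N -> `|X j k| < 4^-1.
  by move=> jN kN; apply: grid; rewrite ?in01.
have Ys j k : (j <= N.+1)%N -> (k <= N.+1)%N -> `|Y j k| < 4^-1.
  by move=> jN kN; apply: grid; rewrite ?in01.
(* The signed sum of increments around a small square is an integer, and four terms below 1/4 force
   it to be 0. *)
have square j k : (j <= N)%N -> (k <= N)%N ->
    X j k + Y j k.+1 = Y j k + X j.+1 k.
  move=> jN kN; apply/eqP; rewrite -subr_eq0; apply/eqP.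
  have x1 : `|X j k| < 4^-1 by apply: Xs; lia.
  have x2 : `|X j.+1 k| < 4^-1 by apply: Xs; lia.
  have y1 : `|Y j k| < 4^-1 by apply: Ys; lia.
  have y2 : `|Y j k.+1| < 4^-1 by apply: Ys; lia.
  have lt1 : `|X j k + Y j k.+1 - (Y j k + X j.+1 k)| < 1.
    by move: x1 x2 y1 y2; rewrite !ltr_norml; lra.
  move: lt1; rewrite /X /Y.
  have [c1 ->] := cfrac_int (P j k.+1 - P j k).
  have [c2 ->] := cfrac_int (P j.+1 k.+1 - P j k.+1).
  have [c3 ->] := cfrac_int (P j.+1 k - P j k).
  have [c4 ->] := cfrac_int (P j.+1 k.+1 - P j.+1 k).
  rewrite [X in `|X|](_ : _ = (c3 + c4 - c1 - c2)%:~R); last first.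
    by rewrite !(intrD, intrN); ring.
  move=> /small_int c0.
  rewrite [LHS](_ : _ = (c3 + c4 - c1 - c2)%:~R); last first.
    by rewrite !(intrD, intrN); ring.
  by rewrite c0.
pose W j := \sum_(k < N.+1) X j k.
(* The difference of two rows telescopes to the cross increments at the two ends, which agree
   because each loop is closed. *)
have WS j : (j <= N)%N -> W j.+1 = W j.
  move=> jN; apply/eqP; rewrite -subr_eq0 /W -sumrB; apply/eqP.
  rewrite (eq_bigr (fun k : 'I_N.+1 => Y j k.+1 - Y j k)); last first.
    by move=> k _; have := square j k jN (ltn_ord k); lra.
  rewrite -(big_mkord xpredT (fun k => Y j k.+1 - Y j k)) telescope_sumr //.
  by rewrite /Y /P mul0r hN !closed subrr.
have WN j : (j <= N.+1)%N -> W j = W 0%N.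
  by elim: j => // j IH jN; rewrite WS // IH // ltnW.
have : W N.+1 = 0.
  rewrite /W big1 // => k _; rewrite /X /P hN cst (cst (_ * h)) subrr.
  exact: cfrac0.
rewrite WN // /W (eq_bigr (fun=> h * d%:~R)) => [|k _].
  rewrite sumr_const card_ord -mulr_natl mulrA hN mul1r => /eqP.
  by rewrite intr_eq0 => /eqP.
rewrite /X /P mul0r; have [c ->] := lin (k.+1%:R * h).
have [c' ->] := lin (k%:R * h).
rewrite [X in cfrac X](_ : _ = h * d%:~R + (c - c')%:~R); last first.
  by rewrite intrB -natr1; ring.
rewrite cfracD cfrac_id // normrM gtr0_norm // /h mulrC ltr_pdivrMr //.
have : (2 * `|d|%N%:R < N.+1%:R :> R) by rewrite -natrM ltr_nat; lia.
rewrite -intr_norm -abszE -pmulrn; lra.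
Qed.

End Winding.

(** * Topology of the torus *)

Section ConnectedComponents.

(** A connected subset that is clopen in [A] is a component. Relative clopenness is certified by a
    partition of [A] into two open sets, as for regions, or into two closed sets, as for strata. *)
Lemma component_clopen (X : topologicalType) (A B : set X) x :
  B `<=` A -> connected B -> B x ->
  (open B /\ open (A `\` B)) \/ (closed B /\ closed (A `\` B)) ->
  connected_component A x = B.
Proof.
move=> BA cB Bx clopen; apply/seteqP; split; last exact: connected_component_max.
set D := connected_component A x.
have DA : D `<=` A by exact: connected_component_sub.
have DB : D `&` B = D `&` ~` (A `\` B).
  apply/seteqP; split=> y [Dy By]; split=> //; first by case.
  by apply: contrapT => nBy; apply: By; split=> //; exact: DA.
suff <- : D `&` B = D by apply: subIsetr.
have cD : connected D by exact: component_connected.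
apply: cD.
- by exists x; split=> //; apply: connected_component_refl; exact: BA.
- case: clopen => -[oB oAB]; first by exists B.
  by exists (~` (A `\` B)) => //; exact: closed_openC.
- case: clopen => -[oB oAB]; last by exists B.
  by exists (~` (A `\` B)) => //; exact: open_closedC.
Qed.

Lemma continuous_within_comp (X Y Z : topologicalType) (A : set Y)
    (h : X -> Y) (f : Y -> Z) :
  continuous h -> (forall x, A (h x)) -> {within A, continuous f} ->
  continuous (f \o h).
Proof.
move=> ch Ah /subspace_continuousP cf x V /(cf _ (Ah x)).
rewrite /= => /ch; rewrite nbhs_simpl /=; apply: filterS => y /=; exact.
Qed.

End ConnectedComponents.

(** * Continuity, connectedness and lattice points in the space of columns *)

Section ColumnTopology.
Context (R : realType).

Lemma continuous_cv (X : topologicalType) p (f : X -> 'cV[R]_p) :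
  (forall i, continuous (fun x => f x i 0)) -> continuous f.
Proof.
move=> cf x V [P nP PV]; rewrite nbhs_simpl /=.
have : \forall y \near x, forall i : 'I_p, P i 0 (f y i 0).
  by apply: filter_forall => i; apply: cf; exact: nP.
by apply: filterS => y Py; apply: PV => i j; rewrite (ord1 j).
Qed.

Lemma continuous_affine p n (A : 'M[R]_(p, n)) (b : 'cV[R]_p) :
  continuous (fun x : 'cV[R]_n => A *m x - b).
Proof.
apply: continuous_cv => i x.
rewrite [X in continuous_at _ X](_ : _ = fun y : 'cV_n =>
  - b i 0 + \sum_j A i j * y j 0); last first.
  by apply/funext => y; rewrite !mxE addrC.
elim: (index_enum _) => [|j r IH].
  rewrite [X in continuous_at _ X](_ : _ = fun=> - b i 0).
    exact: cst_continuous.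
  by apply/funext => y; rewrite big_nil addr0.
rewrite [X in continuous_at _ X](_ : _ = (fun y : 'cV_n => A i j * y j 0 +
  (- b i 0 + \sum_(j <- r) A i j * y j 0))); last first.
  by apply/funext => y; rewrite big_cons addrCA.
apply: cvgD IH; apply: cvgM; [exact: cvg_cst|exact: coord_continuous].
Qed.

Lemma convex_connected n (U : set 'cV[R]_n) : segment_convex U -> connected U.
Proof.
move=> cU; have [[x0 Ux0]|U0] := pselect (U !=set0); last first.
  suff -> : U = set0 by exact: connected0.
  by apply/seteqP; split=> // x Ux; apply: U0; exists x.
have -> : U = \bigcup_(x in U)
    ((fun s : R => s *: x + (1 - s) *: x0) @` `[0, 1]%classic).
  apply/seteqP; split=> [x Ux|_ [x Ux] [s /= s01 <-]].
    exists x => //; exists 1; first by rewrite /= in_itv /= ler01 lexx.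
    by rewrite subrr scale0r scale1r addr0.
  by apply: cU => //; move: s01; rewrite in_itv.
apply: bigcup_connected.
  exists x0 => x Ux; exists 0; first by rewrite /= in_itv /= lexx ler01.
  by rewrite scale0r subr0 scale1r add0r.
move=> x Ux; apply: connected_continuous_connected; first exact: segment_connected.
apply: continuous_subspaceT; apply: continuous_cv => i s.
rewrite [X in continuous_at _ X](_ : _ = fun s => s * x i 0 + (1 - s) * x0 i 0);
  last by apply/funext => y; rewrite !mxE.
apply: cvgD; apply: cvgM; try exact: cvg_cst; first exact: cvg_id.
by apply: cvgB; [exact: cvg_cst|exact: cvg_id].
Qed.

(** Two lattice points within 1/2 of the same point coincide, so a limit of lattice points is itself
    one of them. *)
Lemma closed_lattice_subset p (K : set 'cV[int]_p) :
  closed [set intv R k | k in K].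
Proof.
move=> y cl.
have half : 0 < 2^-1 :> R by rewrite invr_gt0.
have [_ [[k1 Kk1 <-] [_ y1]]] := cl _ (nbhsx_ballx y _ half).
apply: contrapT => nD.
have [i yi] : exists i, y i 0 != intv R k1 i 0.
  apply: contrapT => /forallNP E; apply: nD; exists k1 => //.
  by apply/matrixP => i j; rewrite (ord1 j); have /negP := E i; rewrite negbK => /eqP ->.
pose e := Num.min 2^-1 `|y i 0 - intv R k1 i 0|.
have e0 : 0 < e by rewrite lt_min half normr_gt0 subr_eq0.
have [_ [[k2 Kk2 <-] [_ y2]]] := cl _ (nbhsx_ballx y _ e0).
have k12 : k1 = k2.
  apply/matrixP => j l; rewrite (ord1 l); apply/eqP; rewrite -subr_eq0; apply/eqP.
  apply: (@small_int R); rewrite intrB.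
  have := y1 j 0; have := y2 j 0; rewrite /ball /= !mxE lt_min => /andP[h2 _] h1.
  rewrite -(subrKA (y j 0)); apply: le_lt_trans (ler_normD _ _) _.
  by rewrite (distrC _ (y j 0)); lra.
have := y2 i 0; rewrite -k12 /ball /= lt_min => /andP[_].
by rewrite ltxx.
Qed.

(** The integer part is locally constant away from the integers, so an arbitrary set [K] of labels
    gives an open set. *)
Lemma open_cells p (K : set 'cV[int]_p) :
  open [set y : 'cV[R]_p | (forall i, y i 0 \isn't a Num.int) /\
    K (map_mx Num.floor y)].
Proof.
rewrite openE => y [yZ Ky].
pose P (i : 'I_p) (_ : 'I_1) :=
  `](Num.floor (y i 0))%:~R, (Num.floor (y i 0) + 1)%:~R[%classic : set R.
exists P.
  move=> i j; rewrite (ord1 j) /P; apply: open_nbhs_nbhs; split.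
    exact: interval_open.
  rewrite /= in_itv /=; have := floor_itv (y i 0) => /andP[y1 ->].
  by rewrite lt_neqAle y1 !andbT -intrEfloor; exact: yZ.
move=> y' Py'; have flE i : Num.floor (y' i 0) = Num.floor (y i 0).
  by apply: floor_def; have := Py' i 0; rewrite /P /= in_itv /= => /andP[/ltW -> ->].
split=> [i|].
  have := Py' i 0; rewrite /P /= in_itv /= => /andP[y'i _].
  by rewrite intrEfloor flE lt_eqF.
rewrite (_ : map_mx _ y' = map_mx Num.floor y) //.
by apply/matrixP => i j; rewrite (ord1 j) !mxE flE.
Qed.

End ColumnTopology.

(** * The quotient torus: loops, components of intersections, and cells *)

Section TorusTopology.
Context (R : realType) (n : nat).
Local Notation T := (torus R n).
Local Notation pr := (@torus_proj R n).
Local Notation rmx := (map_mx (intr : int -> R)).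

Lemma torus_projE x y : pr x = pr y <-> exists z, x = y + intv R z.
Proof.
split=> [/torus_projP[z xy]|[z ->]]; last first.
  by apply/torus_projP; exists z; rewrite addrC addKr.
by exists z; rewrite /intv -xy addrC subrK.
Qed.

Lemma torus_projK (q : T) : pr (repr q) = q.
Proof. exact: reprK. Qed.

Lemma torus_proj_box (q : T) : exists2 x, unit_box x & q = pr x.
Proof.
exists (fracv (repr q)); first exact: fracv_box.
rewrite -{1}(torus_projK q); apply/torus_projE.
by exists (map_mx Num.floor (repr q : 'cV[R]_n)); rewrite /fracv subrK.
Qed.

Lemma torus_proj_continuous : continuous pr.
Proof. exact: pi_continuous. Qed.

Lemma torus_openE (V : set T) : open V = open (pr @^-1` V).
Proof. by []. Qed.

Lemma torus_closedE (V : set T) : closed (pr @^-1` V) -> closed V.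
Proof.
by rewrite -!openC torus_openE preimage_setC.
Qed.

Lemma connected_proj (U : set 'cV[R]_n) : segment_convex U -> connected (pr @` U).
Proof.
move=> cU; apply: connected_continuous_connected; first exact: convex_connected.
by apply: continuous_subspaceT; exact: torus_proj_continuous.
Qed.

Lemma torus_connected : connected [set: T].
Proof.
have <- : pr @` setT = setT.
  by apply/seteqP; split=> // q _; exists (repr q) => //; exact: torus_projK.
by apply: connected_proj.
Qed.

Lemma unit_ballZ (c : R) (x : 'cV[R]_n) :
  `|c| <= 1 -> unit_ball R n x -> unit_ball R n (c *: x).
Proof.
move=> c1; apply: le_lt_trans; apply: ler_sum => i _.
rewrite mxE exprMn ler_piMl ?sqr_ge0 // -real_normK ?num_real //.
by rewrite expr_le1.
Qed.

(** The section [repr] need not be continuous, but its coordinates are continuous modulo 1, which is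
    all that [winding_number0] asks for. *)
Lemma near_cfrac (q : T) (i : 'I_n) : \forall r \near q,
  `|cfrac ((repr r : 'cV[R]_n) i 0 - (repr q : 'cV[R]_n) i 0)| < 8^-1.
Proof.
pose c := (repr q : 'cV[R]_n) i 0.
pose O : set T := [set r | `|cfrac ((repr r : 'cV[R]_n) i 0 - c)| < 8^-1].
apply: (@open_nbhs_nbhs _ q O); split; last first.
  by rewrite /O /= subrr cfrac0 normr0 invr_gt0.
rewrite torus_openE.
have -> : pr @^-1` O = [set y : 'cV[R]_n | `|cfrac (y i 0 - c)| < 8^-1].
  apply/seteqP; split=> y; rewrite /O /=;
    have /torus_projE[z ->] := torus_projK (pr y);
    by rewrite !mxE addrAC cfracD.
rewrite openE => y /= yO; pose e := 8^-1 - `|cfrac (y i 0 - c)|.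
have e0 : 0 < e by rewrite subr_gt0.
apply: filterS (nbhsx_ballx y _ e0) => y' [_ /(_ i 0)]; rewrite /ball /= => yy'.
rewrite -(subrKA (y i 0)); apply: le_lt_trans (cfrac_normD _ _) _.
have := cfrac_norm_le (y' i 0 - y i 0); rewrite (distrC (y' i 0)).
by rewrite /e in yy'; lra.
Qed.

(* Contracting the loop [s |-> x + s v] through the ball makes its winding number
   [v i] around each coordinate circle vanish. *)
Lemma ball_no_loop (C : set T) (x : 'cV[R]_n) (v : 'cV[int]_n) :
  homeomorphic C (unit_ball R n) ->
  (forall s : R, C (pr (x + s *: intv R v))) -> v = 0.
Proof.
move=> [f [g [fC gB fK gK [cf cg]]]] Cv.
apply/matrixP => i j; rewrite (ord1 j) [RHS]mxE.
pose line (t : R) := pr (x + t *: intv R v).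
pose loop := f \o line.
have loopB t : unit_ball R n (loop t) by apply: fC; exists (line t) => //; exact: Cv.
have cloop : continuous loop.
  apply: (continuous_within_comp _ Cv cf) => t.
  apply: continuous_comp; last exact: torus_proj_continuous.
  by apply: cvgD; [exact: cvg_cst|apply: cvgZr_tmp; exact: cvg_id].
(* The factor [cos (pi / 2 * u)] goes from 1 at [u = 0] to 0 at [u = 1] and stays in [[-1, 1]] for
   all real [u], so the homotopy remains in the ball on the whole plane. *)
pose h (p : R * R) := cos (pi / 2 * p.1) *: loop p.2.
have hB p : unit_ball R n (h p).
  by apply: unit_ballZ => //; rewrite ler_norml cos_geN1 cos_le1.
have ch : continuous h.
  move=> p; apply: cvgZ.
    apply: (@continuous_comp _ _ _ (fun p : R * R => pi / 2 * p.1) cos);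
      last exact: continuous_cos.
    by apply: cvgM; [exact: cvg_cst|exact: cvg_fst].
  apply: (@continuous_comp _ _ _ snd loop); [exact: cvg_snd|exact: cloop].
have cF : continuous (g \o h) by exact: continuous_within_comp cg.
pose phi u t := (repr (g (h (u, t))) : 'cV[R]_n) i 0.
apply: (@winding_number0 R phi).
- move=> p; have := cF p _ (near_cfrac (g (h p)) i).
  rewrite nbhs_simpl /=; apply: filterS => -[q1 q2] /=.
  by rewrite /phi -surjective_pairing.
- move=> u; rewrite /phi /h /=; congr (fun_of_matrix (repr (g (_ *: _))) i 0).
  congr f; apply/esym/torus_projE; exists v.
  by rewrite scale1r scale0r addr0.
- move=> t; rewrite /phi /h /= mulr1 cos_pihalf !scale0r //.
- move=> t; rewrite /phi /h /= mulr0 cos0 !scale1r /loop /= (fK _ (Cv t)) (fK _ (Cv 0)).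
  have [z zE] := (torus_projE _ _).1 (torus_projK (pr (x + t *: intv R v))).
  have [w wE] := (torus_projE _ _).1 (torus_projK (pr (x + 0 *: intv R v))).
  exists (z i 0 - w i 0); rewrite zE wE !mxE mul0r intrB; ring.
Qed.

(** Upstairs, the set is a disjoint union of affine pieces labelled by [k], and the piece through
    [x0] projects onto the labels [k0 + a z]. These labels and the remaining ones both give closed
    sets, by [closed_lattice_subset]. *)
Lemma lattice_component p (a : 'M[int]_(p, n)) (b : 'cV[R]_p) x0 :
  (exists k, rmx a *m x0 = b + intv R k) ->
  connected_component
    (pr @` [set x | exists k, rmx a *m x = b + intv R k]) (pr x0) =
  pr @` [set x | rmx a *m x = rmx a *m x0].
Proof.
move=> [k0 k0E]; set A := pr @` _; set B := pr @` _.
pose L (K : set 'cV[int]_p) :=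
  [set x : 'cV[R]_n | exists2 k, K k & rmx a *m x = b + intv R k].
have cL K : closed (L K).
  have -> : L K = (fun x : 'cV[R]_n => rmx a *m x - b) @^-1` [set intv R k | k in K].
    apply/seteqP; split=> x [k Kk E]; exists k => //; first by rewrite E addrC addKr.
    by rewrite E addrC subrK.
  apply: closed_comp; last exact: closed_lattice_subset.
  by move=> x _; exact: continuous_affine.
have BL : pr @^-1` B = L [set k | exists z, k = k0 + a *m z].
  apply/seteqP; split=> [x [y /= yE /torus_projE[z E]]|x [_ [z ->] E]].
    exists (k0 + a *m (- z)); first by exists (- z).
    rewrite intvD -intv_mul intvN addrA -k0E -yE E mulmxDr mulmxN.
    by rewrite addrK.
  exists (x + intv R (- z)); last first.
    by apply/esym/torus_projE; exists z; rewrite intvN subrK.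
  by rewrite /= mulmxDr E intv_mul mulmxN intvN intvD k0E addrA addrK.
have AE : pr @^-1` A = L setT.
  apply/seteqP; split=> [x [y /= [k yE] /torus_projE[z E]]|x [k _ E]].
    exists (k + a *m (- z)) => //.
    rewrite intvD -intv_mul intvN addrA -yE E mulmxDr mulmxN.
    by rewrite addrK.
  by exists x => //; exists k.
apply: component_clopen.
- by move=> _ [x /= xE <-]; exists x => //; exists k0; rewrite /= xE.
- apply: connected_proj => x y s /= xE yE _.
  by rewrite mulmxDr -!scalemxAr xE yE -scalerDl subrKC scale1r.
- by exists x0.
right; split; apply: torus_closedE; first by rewrite BL.
rewrite (_ : pr @^-1` (A `\` B) = pr @^-1` A `\` pr @^-1` B) // AE BL.
have -> : L setT `\` L [set k | exists z, k = k0 + a *m z] =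
    L [set k | ~ exists z, k = k0 + a *m z]; last exact: cL.
apply/seteqP; split=> [x [[k _ E] nB]|x [k nk E]].
  by exists k => //= kz; apply: nB; exists k.
split; first by exists k.
move=> [k' k'z]; rewrite E => /addrI /intv_inj kk'.
by apply: nk; rewrite /= kk'.
Qed.

Definition cell p (a : 'M[int]_(p, n)) (b : 'cV[R]_p) (k : 'cV[int]_p) :
    set 'cV[R]_n :=
  [set x | forall i, (k i 0)%:~R < (rmx a *m x - b) i 0 < (k i 0 + 1)%:~R].

Lemma cellP p (a : 'M[int]_(p, n)) (b : 'cV[R]_p) k x :
  cell a b k x <-> (forall i, (rmx a *m x - b) i 0 \isn't a Num.int) /\
    map_mx Num.floor (rmx a *m x - b) = k.
Proof.
split=> [xk|[xZ <-] i]; last first.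
  rewrite !mxE; have := xZ i; rewrite !mxE intrEfloor => ne.
  by rewrite lt_neqAle ne /= floor_itv.
have fl i : Num.floor ((rmx a *m x - b) i 0) = k i 0.
  by apply: floor_def; have /andP[/ltW -> ->] := xk i.
split=> [i|]; first by rewrite intrEfloor fl; have /andP[/lt_eqF ->] := xk i.
by apply/matrixP => i j; rewrite (ord1 j) mxE fl.
Qed.

Lemma cell_convex p (a : 'M[int]_(p, n)) (b : 'cV[R]_p) k :
  segment_convex (cell a b k).
Proof.
move=> x y s xk yk /andP[s0 s1] i.
have -> : (rmx a *m (s *: x + (1 - s) *: y) - b) i 0 =
    s * (rmx a *m x - b) i 0 + (1 - s) * (rmx a *m y - b) i 0.
  rewrite mulmxDr -!scalemxAr; move: (rmx a *m x) (rmx a *m y) => X Y.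
  by rewrite !mxE; ring.
have := yk i; have := xk i; set Y := (rmx a *m x - b) i 0.
set X := (rmx a *m y - b) i 0; set l : R := (k i 0)%:~R.
set u : R := (k i 0 + 1)%:~R; move: X Y l u => X Y l u /andP[Y1 Y2] /andP[X1 X2].
(* At [s = 0] strictness comes from [y]; for [s > 0] it comes from the term in [x]. *)
have [->|sn0] := eqVneq s 0; first by rewrite mul0r add0r subr0 mul1r X1 X2.
have {}s0 : 0 < s by rewrite lt_neqAle eq_sym sn0.
apply/andP; split.
  have : s * l < s * Y by rewrite ltr_pM2l.
  have : (1 - s) * l <= (1 - s) * X by rewrite ler_wpM2l ?subr_ge0 // ltW.
  by lra.
have : s * Y < s * u by rewrite ltr_pM2l.
have : (1 - s) * X <= (1 - s) * u by rewrite ler_wpM2l ?subr_ge0 // ltW.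
by lra.
Qed.

Lemma cell_shift p (a : 'M[int]_(p, n)) (b : 'cV[R]_p) k x z :
  cell a b k (x + intv R z) <-> cell a b (k - a *m z) x.
Proof.
rewrite /cell /=.
have -> : rmx a *m (x + intv R z) - b = rmx a *m x - b + intv R (a *m z).
  by rewrite mulmxDr intv_mul addrAC.
move: (rmx a *m x - b) (a *m z) => X Z.
by split=> h i; have := h i; rewrite !mxE !(intrD, intrN); lra.
Qed.

Lemma open_cell_union p (a : 'M[int]_(p, n)) (b : 'cV[R]_p) (K : set 'cV[int]_p) :
  open [set x | exists2 k, K k & cell a b k x].
Proof.
rewrite [X in open X](_ : _ = (fun x => rmx a *m x - b) @^-1`
  [set y : 'cV[R]_p | (forall i, y i 0 \isn't a Num.int) /\
    K (map_mx Num.floor y)]).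
  apply: open_comp; last exact: open_cells.
  by move=> x _; exact: continuous_affine.
apply/seteqP; split=> [x [k Kk /cellP[xZ E]]|x [xZ Kx]]; first by split; rewrite /= ?E.
by eexists; [exact: Kx|apply/cellP].
Qed.

(** As for [lattice_component], sorting the cells by whether their label is in [k + a z]; here both
    unions are open. *)
Lemma cell_component p (a : 'M[int]_(p, n)) (b : 'cV[R]_p) k x0 :
  cell a b k x0 ->
  connected_component
    (pr @` [set x | exists k, cell a b k x]) (pr x0) = pr @` cell a b k.
Proof.
move=> kx0; set A := pr @` _; set B := pr @` _.
pose L (K : set 'cV[int]_p) :=
  [set x : 'cV[R]_n | exists2 k, K k & cell a b k x].
have BL : pr @^-1` B = L [set l | exists z, l = k + a *m z].
  apply/seteqP; split=> [x [y /= ky /torus_projE[z E]]|x [_ [z ->] kx]].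
    exists (k + a *m (- z)); first by exists (- z).
    by move: ky; rewrite E => /cell_shift; rewrite mulmxN.
  exists (x + intv R (- z)); last first.
    by apply/esym/torus_projE; exists z; rewrite intvN subrK.
  by apply/cell_shift; rewrite mulmxN opprK.
have AE : pr @^-1` A = L setT.
  apply/seteqP; split=> [x [y /= [l ly] /torus_projE[z E]]|x [l _ E]].
    exists (l + a *m (- z)) => //.
    by move: ly; rewrite E => /cell_shift; rewrite mulmxN.
  by exists x => //; exists l.
apply: component_clopen.
- by move=> _ [x /= xk <-]; exists x => //; exists k.
- by apply: connected_proj; exact: cell_convex.
- by exists x0.
left; split; rewrite torus_openE; first by rewrite BL; exact: open_cell_union.
rewrite (_ : pr @^-1` (A `\` B) = pr @^-1` A `\` pr @^-1` B) // AE BL.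
have -> : L setT `\` L [set l | exists z, l = k + a *m z] =
    L [set l | ~ exists z, l = k + a *m z]; last exact: open_cell_union.
apply/seteqP; split=> [x [[l _ E] nB]|x [l nl lx]].
  by exists l => //= lz; apply: nB; exists l.
split; first by exists l.
move=> [l' l'z] /cellP[_ E']; have /cellP[_ E] := lx.
by apply: nl; rewrite /= -E E'.
Qed.

End TorusTopology.

(** * Integral linear forms *)

Section IntegralForms.

Lemma clear_denominators n (v : 'cV[rat]_n) : exists (D : int) (c : 'cV[int]_n),
  D != 0 /\ forall i, (c i 0)%:~R = D%:~R * v i 0.
Proof.
exists (\prod_i denq (v i 0)).
exists (\col_i (numq (v i 0) * \prod_(j | j != i) denq (v j 0))); split.
  by apply/prodf_neq0 => i _; exact: denq_neq0.
move=> i; rewrite mxE [X in _ = X%:~R * _](bigD1 i) //=.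
set Q := \prod_(j | _) _; rewrite !intrM mulrAC; congr (_ * _).
by rewrite numqE mulrC.
Qed.

Lemma col_injP (F : fieldType) p n (A : 'M[F]_(p, n)) :
  \rank A = n <-> (forall x : 'cV_n, A *m x = 0 -> x = 0).
Proof.
rewrite -mxrank_tr; split=> [/eqP rA x Ax|inj].
  apply: trmx_inj; apply: (row_free_inj rA).
  by rewrite -trmx_mul Ax trmx0 trmx0 mul0mx.
apply/eqP; apply: inj_row_free => v vA; apply: trmx_inj; rewrite trmx0.
by apply: inj; apply: trmx_inj; rewrite trmx_mul trmxK vA trmx0.
Qed.

Lemma ratr_intmx (R : realType) p n (a : 'M[int]_(p, n)) :
  map_mx ratr (map_mx intr a : 'M[rat]_(p, n)) = map_mx (intr : int -> R) a.
Proof. by apply/matrixP => i j; rewrite !mxE ratr_int. Qed.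

(** The rank of an integer matrix is the same over the rationals and the reals, so a real kernel
    vector forces a rational one; its denominators are then cleared. *)
Lemma integral_kernel (R : realType) p n (a : 'M[int]_(p, n)) (x : 'cV[R]_n) :
  x != 0 -> map_mx (intr : int -> R) a *m x = 0 ->
  exists2 v : 'cV[int]_n, v != 0 & a *m v = 0.
Proof.
move=> x0 ax0.
have [[v v0 av]|inj] := pselect (exists2 v : 'cV[rat]_n, v != 0 &
    map_mx intr a *m v = 0); last first.
  have : \rank (map_mx intr a : 'M[rat]_(p, n)) = n.
    apply/col_injP => v av; apply/eqP; apply: contra_notT inj => v0.
    by exists v.
  rewrite -(mxrank_map (@ratr R)) ratr_intmx => /col_injP /(_ x ax0) /eqP.
  by rewrite (negPf x0).
have [D [c [D0 cE]]] := clear_denominators v.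
have cv : map_mx intr c = D%:~R *: v by apply/matrixP => i j; rewrite (ord1 j) !mxE.
exists c.
  apply: contra_neq v0 => c0; apply: (scalerI (_ : D%:~R != 0 :> rat)).
    by rewrite intr_eq0.
  by rewrite -cv c0 map_mx0 scaler0.
apply/matrixP => i j; apply: (@intr_inj rat).
have : map_mx intr (a *m c) = 0 :> 'cV[rat]_p.
  by rewrite map_mxM cv -scalemxAr av scaler0.
by move=> /matrixP/(_ i j); rewrite !mxE.
Qed.

(** Bezout: [d] is a value of the form of least positive absolute value. It divides every
    coefficient, since a nonzero remainder would be a smaller value. *)
Lemma primitive_form n (c : 'rV[int]_n) : c != 0 ->
  exists (d : int) (r : 'rV[int]_n) (z0 : 'cV[int]_n),
    [/\ d != 0, c = d *: r & (r *m z0) 0 0 = 1].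
Proof.
move=> c0; pose P k := (0 < k)%N && `[< exists z : 'cV[int]_n, absz ((c *m z) 0 0) = k >].
have [i ci] : exists i, c 0 i != 0.
  by apply/existsP; rewrite -negb_forall; apply: contra c0 => /forallP E;
     apply/eqP/matrixP => j l; rewrite (ord1 j) mxE; exact/eqP.
have cdelta j : (c *m (delta_mx j 0 : 'cV_n)) 0 0 = c 0 j.
  by rewrite -colE mxE.
have exP : exists k, P k.
  exists (absz (c 0 i)); rewrite /P absz_gt0 ci /=; apply/asboolP.
  by exists (delta_mx i 0); rewrite cdelta.
have [k /andP[k0 /asboolP[z zk]] kmin] := ex_minnP exP.
set d := (c *m z) 0 0 in zk.
have d0 : d != 0 by rewrite -absz_gt0 zk.
have dvd j : c 0 j = d * divz (c 0 j) d.
  have E := divz_eq (c 0 j) d; rewrite {1}E mulrC -[RHS]addr0; congr (_ + _).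
  apply/eqP; apply: contraT => m0.
  have m_ge0 := modz_ge0 (c 0 j) d0.
  have m_lt := ltz_mod (c 0 j) d0.
  have : P (absz (modz (c 0 j) d)).
    rewrite /P absz_gt0 m0 /=; apply/asboolP.
    exists (delta_mx j 0 - divz (c 0 j) d *: z).
    rewrite mulmxBr -scalemxAr !mxE -/d.
    have := cdelta j; rewrite mxE => ->; have := erefl d; rewrite {1}/d mxE => ->.
    by congr absz; rewrite {1}E addrC addrK.
  by move=> /kmin; lia.
exists d, (\row_j divz (c 0 j) d), z; split=> //.
  by apply/matrixP => j l; rewrite (ord1 j) !mxE -dvd.
apply: (mulfI d0); rewrite mulr1 -[RHS]/((c *m z) 0 0) !mxE big_distrr /=.
by apply: eq_bigr => j _; rewrite !mxE mulrA -dvd.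
Qed.

End IntegralForms.

(** * Toric subspaces *)

Section ToricSubspaces.
Context (R : realType) (n : nat).
Local Notation pr := (@torus_proj R n).
Local Notation rmx := (map_mx (intr : int -> R)).

(** Once the normal is primitive, translating a single hyperplane by multiples of [z0] reaches every
    integer offset, so the full preimage of [V] is cut out by an integrality condition. *)
Lemma toric_hyperplane_normal (V : set (torus R n)) : toric_hyperplane V ->
  exists (r : 'rV[int]_n) (b : R), (exists z0 : 'cV[int]_n, (r *m z0) 0 0 = 1) /\
    forall x, V (pr x) <-> (rmx r *m x) 0 0 - b \is a Num.int.
Proof.
move=> [a [b [a0 ->]]]; have [D [c [D0 cE]]] := clear_denominators a.
have c0 : c^T != 0.
  apply: contra_neq a0 => cT0; apply/matrixP => i j; rewrite (ord1 j) [RHS]mxE.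
  apply: (@mulfI _ D%:~R); first by rewrite intr_eq0.
  by rewrite -cE mulr0 -[c]trmxK cT0 !mxE.
have [d [r [z0 [d0 cdr rz0]]]] := primitive_form c0.
have d0R : d%:~R != 0 :> R by rewrite intr_eq0.
have D0R : D%:~R != 0 :> R by rewrite intr_eq0.
have sumE (x : 'cV[R]_n) : \sum_(i < n) ratr (a i 0) * x i 0 =
    d%:~R / D%:~R * (rmx r *m x) 0 0.
  rewrite mxE big_distrr /=; apply: eq_bigr => i _; rewrite mulrA; congr (_ * _).
  apply: (mulfI D0R); rewrite mxE.
  rewrite [RHS](_ : _ = d%:~R * (r 0 i)%:~R); last by field.
  have := congr1 (@ratr R) (cE i); rewrite rmorphM /= !ratr_int => <-.
  rewrite -intrM; congr (_%:~R).
  by have /matrixP/(_ 0 i) := cdr; rewrite !mxE.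
have shift (x : 'cV[R]_n) w : (rmx r *m (x + intv R w)) 0 0 =
    (rmx r *m x) 0 0 + ((r *m w) 0 0)%:~R.
  by rewrite mulmxDr intv_mul mxE; congr (_ + _); rewrite mxE.
(* The original form is [d / D] times [r], hence the rescaled constant. *)
exists r, (b * D%:~R / d%:~R); split; first by exists z0.
move=> x; split=> [[y /= yb /torus_projE[z yE]]|/intrP[k kE]].
  have -> : x = y + intv R (- z) by rewrite yE intvN addrK.
  rewrite shift -yb sumE; set s := (rmx r *m y) 0 0.
  rewrite [X in X \is a _](_ : _ = ((r *m - z) 0 0)%:~R) ?intr_int //.
  by field; apply/andP.
exists (x + intv R (- (k *: z0))).
  have kz0 : (r *m - (k *: z0)) 0 0 = - k.
    rewrite mulmxN -scalemxAr; move: (r *m z0) rz0 => M M1.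
    by rewrite !mxE M1 mulr1.
  rewrite /= sumE shift kz0 intrN -kE.
  by field; apply/andP.
by apply/esym/torus_projE; exists (k *: z0); rewrite intvN subrK.
Qed.

(** At [t = 0] only the strata of dimension 0 survive, and dimension 0 can be read off the set
    itself: it is a single point. *)
Lemma toric_subspace_dim0 k (V : set (torus R n)) :
  toric_subspace k V -> k = 0%N <-> exists q, V = [set q].
Proof.
move=> [p [A [c [[x /= xc] -> ->]]]].
have rA : \rank (map_mx (@ratr R) A) = \rank A by rewrite mxrank_map.
split=> [/eqP|[q Vq]].
  rewrite subn_eq0 => nr.
  have /col_injP inj : \rank (map_mx (@ratr R) A) = n.
    by apply/eqP; rewrite eqn_leq rA nr -rA rank_leq_col.
  exists (pr x); apply/seteqP; split=> [_ [y /= yc <-]|_ ->]; last by exists x.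
  congr pr; apply/eqP; rewrite -subr_eq0; apply/eqP/inj.
  by rewrite mulmxBr xc yc subrr.
apply/eqP; rewrite subn_eq0 -rA; apply/eq_leq/esym/col_injP => v Av.
have xq (s : R) : pr (x + s *: v) = q.
  suff : [set q] (pr (x + s *: v)) by [].
  by rewrite -Vq; exists (x + s *: v); rewrite //= mulmxDr -scalemxAr Av scaler0 addr0.
apply/matrixP => i j; rewrite (ord1 j) [RHS]mxE; apply/eqP; apply: contraT => vi.
(* This multiple of [v] moves coordinate [i] by 1/2, so the two projections cannot coincide. *)
have /torus_projE[z zE] : pr (x + (2 * v i 0)^-1 *: v) = pr (x + 0 *: v).
  by rewrite !xq.
have := congr1 (fun M : 'cV_n => M i 0) zE; rewrite !mxE mul0r addr0 => /addrI.
rewrite invfM mulfVK // => z2.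
have z2' : (2 * z i 0)%:~R = 1%:~R :> R by rewrite intrM -z2 mulfV.
by move/intr_inj: z2'; lia.
Qed.

Lemma toric_dim_eq0 k (V : set (torus R n)) :
  toric_subspace k V -> (toric_dim V == 0%N) = (k == 0%N).
Proof.
move=> Vk; rewrite /toric_dim; case: xgetP => [l _ Vl|/(_ k) //].
have := toric_subspace_dim0 Vk; have := toric_subspace_dim0 Vl => hl hk.
by apply/eqP/eqP => [/hl/hk|/hk/hl].
Qed.

Lemma euler_toric_subspace p (a : 'M[int]_(p, n)) (b : 'cV[R]_p) x0 :
  (exists k, rmx a *m x0 = b + intv R k) ->
  let C := pr @` [set x | rmx a *m x = rmx a *m x0] in
  euler (fun x => `[< C (pr x) >]%:Z) (toric_dim C == 0%N)%:Z.
Proof.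
move=> [k0 k0E] C.
have dimC : toric_subspace (n - \rank (map_mx intr a : 'M[rat]_(p, n))) C.
  exists p, (map_mx intr a), (rmx a *m x0); rewrite ratr_intmx; split=> //.
  by exists x0.
rewrite (toric_dim_eq0 dimC) subn_eq0.
have rA : \rank (map_mx intr a : 'M[rat]_(p, n)) = \rank (rmx a).
  by rewrite -ratr_intmx mxrank_map.
have [[x x_neq0 ax0]|inj] := pselect (exists2 x : 'cV_n, x != 0 & rmx a *m x = 0).
  have -> : (n <= \rank (map_mx intr a : 'M[rat]_(p, n)))%N = false.
    apply: contra_neqF x_neq0 => nr; have /col_injP : \rank (rmx a) = n; last exact.
    by apply/eqP; rewrite eqn_leq -rA nr rA rank_leq_col.
  (* The values taken on the lattice translates of the affine subspace through [x0]; membership in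
     [K] is membership in [C] downstairs. *)
  pose K := [set y | exists z, y = rmx a *m x0 + intv R (a *m z)].
  have := @euler_subtorus R p n a b K _ _ (ex_intro2 _ _ x x_neq0 ax0).
  move=> E; apply: euler_ext (E _ _).
  - move=> y _; congr (Posz (nat_of_bool _)); apply/asbool_equiv_eq; split.
      move=> [z yE]; exists (y + intv R (- z)); last first.
        by apply/esym/torus_projE; exists z; rewrite intvN subrK.
      by rewrite /= mulmxDr yE intv_mul mulmxN intvN addrK.
    move=> [u /= uE /torus_projE[z zE]]; exists (- z).
    by rewrite -uE zE mulmxDr intv_mul mulmxN intvN addrK.
  - by move=> _ [z ->]; exists (k0 + a *m z); rewrite k0E intvD addrA.
  - by move=> _ w [z ->]; exists (z + w); rewrite mulmxDr intvD addrA.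
have {}inj (x : 'cV_n) : rmx a *m x = 0 -> x = 0.
  by move=> ax; apply/eqP; apply: contra_notT inj => x_neq0; exists x.
have /col_injP rn := inj.
rewrite rA rn leqnn.
apply: euler_ext (euler_point (fracv_box x0)) => x bx.
congr (Posz (nat_of_bool _)); apply/eqP/asboolP => [->|[y /= yE /torus_projE[z zE]]].
  exists x0 => //; apply/torus_projE; exists (map_mx Num.floor x0).
  by rewrite /fracv subrK.
have yx0 : y = x0.
  by apply/eqP; rewrite -subr_eq0; apply/eqP/inj; rewrite mulmxBr yE subrr.
apply: (@unit_box_eq _ _ _ _ (map_mx Num.floor x0 - z)) => //.
  exact: fracv_box.
rewrite /fracv intvD intvN addrA subrK -yx0 zE.
by rewrite addrK.
Qed.

End ToricSubspaces.

(** * Toric arrangements *)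

Section Arrangement.
Context (R : realType) (n m : nat) (H : 'I_m -> set (torus R n)).
Context (a : 'M[int]_(m, n)) (b : 'cV[R]_m).
Local Notation pr := (@torus_proj R n).
Local Notation rmx := (map_mx (intr : int -> R)).
Hypothesis HE : forall i x, H i (pr x) <-> (rmx a *m x - b) i 0 \is a Num.int.
Hypothesis H_proper : forall i, H i <> setT.

(* Rows outside S are replaced by the trivially satisfied condition 0 = 0. *)
Let aS (S : {set 'I_m}) : 'M[int]_(m, n) := \matrix_(i, j) (if i \in S then a i j else 0).
Let bS (S : {set 'I_m}) : 'cV[R]_m := \col_i (if i \in S then b i 0 else 0).

Let P := intersection_poset H.
Let W := ~` \bigcup_i H i.

Let aSE S x i : (rmx (aS S) *m x - bS S) i 0 =
  if i \in S then (rmx a *m x - b) i 0 else 0.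
Proof.
rewrite !mxE; case: ifP => iS.
  by congr (_ - _); apply: eq_bigr => j _; rewrite !mxE iS.
by rewrite subr0 big1 // => j _; rewrite !mxE iS mul0r.
Qed.

Lemma bigcap_lattice (S : {set 'I_m}) : \bigcap_(i in [set` S]) H i =
  pr @` [set x | exists k, rmx (aS S) *m x = bS S + intv R k].
Proof.
apply/seteqP; split=> [q Hq|_ [x /= [k kE] <-] i /= iS].
  exists (repr q : 'cV[R]_n); last exact: torus_projK.
  move: Hq; rewrite -{1}(torus_projK q); move: (repr q : 'cV[R]_n) => x Hx.
  set y := rmx (aS S) *m x - bS S; exists (map_mx Num.floor y).
  suff -> : intv R (map_mx Num.floor y) = y by rewrite addrC subrK.
  apply/matrixP => i j; rewrite (ord1 j) 2!mxE floorK // /y aSE.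
  by case: ifP => iS; [apply/HE/Hx|exact: rpred0].
apply/HE; have := aSE S x i; rewrite iS => <-.
by rewrite kE addrAC subrr add0r mxE intr_int.
Qed.

Lemma complement_cells : W = pr @` [set x | exists k, cell a b k x].
Proof.
apply/seteqP; split=> [q Wq|_ [x /= [k /cellP[xZ _]] <-] [i _ /HE]]; last first.
  by rewrite (negPf (xZ i)).
exists (repr q : 'cV[R]_n); last exact: torus_projK.
exists (map_mx Num.floor (rmx a *m (repr q : 'cV[R]_n) - b)).
apply/cellP; split=> // i; apply/negP => /HE Hi; apply: Wq; exists i => //.
by rewrite torus_projK in Hi.
Qed.

Lemma stratumP C : P C -> C <> set0 -> exists (S : {set 'I_m}) x0,
  [/\ unit_box x0, exists k, rmx (aS S) *m x0 = bS S + intv R k &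
      C = pr @` [set x | rmx (aS S) *m x = rmx (aS S) *m x0]].
Proof.
move=> [->//|[S [q Hq <-]] _]; have [x0 bx0 qE] := torus_proj_box q.
move: Hq; rewrite qE bigcap_lattice => -[x1 /= [k1 k1E] /torus_projE[z zE]].
have k0 : exists k, rmx (aS S) *m x0 = bS S + intv R k.
  exists (k1 - aS S *m z); rewrite intvD intvN addrA -k1E zE mulmxDr intv_mul.
  by rewrite addrK.
by exists S, x0; split=> //; rewrite lattice_component.
Qed.

(** A nonempty stratum is determined by the index set [S] and the integer label of one of its points
    in the unit box. *)
Lemma intersection_poset_finite : finite_set P.
Proof.
pose F S k := pr @` [set x | rmx (aS S) *m x = bS S + intv R k].
have [N NP] : exists N, forall S, forall x, unit_box x ->
    forall i, `|map_mx Num.floor (rmx (aS S) *m x - bS S) i 0| <= N%:Z.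
  have /choice[f fP] := fun S => label_bounded (rmx (aS S)) (bS S).
  exists (\max_S f S)%N => S x bx i; apply: le_trans (fP S x bx i) _.
  by rewrite lez_nat leq_bigmax.
pose D := [set Sk : {set 'I_m} * 'cV[int]_m | forall i, `|Sk.2 i 0| <= N%:Z].
have finD : finite_set D.
  have -> : D = setT `*` [set k : 'cV[int]_m | forall i, `|k i 0| <= N%:Z].
    by apply/seteqP; split=> [[S k] //|[S k] []].
  by apply: finite_setX; [exact: finite_finset|exact: finite_int_box].
have finU : finite_set ([set set0] `|` [set F Sk.1 Sk.2 | Sk in D]).
  by rewrite finite_setU; split; [exact: finite_set1|exact: finite_image].
apply: sub_finite_set finU => C PC.
have [->|C0] := pselect (C = set0); [by left|right].
have [S [x0 [bx0 [k kE] ->]]] := stratumP PC C0.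
exists (S, k); last by rewrite /F /= -kE.
move=> i /=; have := NP S x0 bx0 i.
by rewrite kE addrAC subrr add0r !mxE intrKfloor.
Qed.

Lemma regionP C : regions H C -> exists k x0,
  [/\ unit_box x0, cell a b k x0 & C = pr @` cell a b k].
Proof.
move=> [q Wq <-]; have [x0 bx0 qE] := torus_proj_box q.
move: Wq; rewrite -/W qE complement_cells => -[x1 /= [k1 k1x] /torus_projE[z zE]].
exists (k1 - a *m z), x0.
have kx0 : cell a b (k1 - a *m z) x0.
  by apply: (cell_shift a b k1 x0 z).1; rewrite -zE.
by split=> //; exact: cell_component.
Qed.

Lemma regions_finite : finite_set (regions H).
Proof.
have [N NP] := label_bounded (rmx a) b.
have fin := finite_image (fun k => pr @` cell a b k) (finite_int_box m N).
apply: sub_finite_set fin => C /regionP[k [x0 [bx0 kx0 ->]]].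
by exists k => // i; have := NP x0 bx0 i; have /cellP[_ ->] := kx0.
Qed.

Lemma complement_regions q : `[< W q >]%:Z =
  \sum_(C <- fset_set (regions H)) `[< C q >]%:Z.
Proof.
have [Wq|nW] := asboolP (W q); last first.
  rewrite big_seq big1 // => C; rewrite in_fset_set; last exact: regions_finite.
  rewrite inE => -[q' Wq' <-]; rewrite asboolF // => /connected_component_sub.
  exact: nW.
have C0 : connected_component W q \in fset_set (regions H).
  by rewrite in_fset_set ?inE; [exists q|exact: regions_finite].
rewrite (big_rem (connected_component W q)) //= asboolT; last first.
  exact: connected_component_refl.
rewrite big_seq big1 ?addr0 // => C; rewrite mem_rem_uniq ?fset_uniq // inE.
move=> /andP[/eqP ne]; rewrite in_fset_set; last exact: regions_finite.
rewrite inE => -[q' Wq' CE]; rewrite asboolF // -CE => /same_connected_component E.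
by apply: ne; rewrite -CE E.
Qed.

Local Notation mu := (mobius P (@rev_incl R n) setT).

(** The strata through [q] form the interval from the torus to the smallest of them, [y]. The
    recursion makes the sum of [mu] over it 0 unless [y] is the whole torus, which happens exactly
    when no hyperplane passes through [q]. *)
Lemma mobius_sum_strata q :
  \sum_(C \in [set C | P C /\ C q]) mu C = `[< W q >]%:Z.
Proof.
pose S : {set 'I_m} := [set i | `[< H i q >]]%SET.
pose y := connected_component (\bigcap_(i in [set` S]) H i) q.
have Sq : (\bigcap_(i in [set` S]) H i) q by move=> i /=; rewrite inE => /asboolP.
have yq : y q by exact: connected_component_refl.
have Py : P y by right; exists S, q.
have PE : [set C | P C /\ C q] = [set C | P C /\ y `<=` C].
  apply/seteqP; split=> C [PC Cq]; split=> //; last exact: Cq.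
  case: PC Cq => [->//|[S' [q' Sq' <-]]] Cq.
  rewrite (same_connected_component Cq); apply: connected_component_max => //.
    move=> r /connected_component_sub Sr i /= iS'; apply: Sr => /=.
    by rewrite inE; apply/asboolP; exact: (connected_component_sub Cq).
  exact: component_connected.
have anti (A B : set (torus R n)) : rev_incl A B -> rev_incl B A -> A = B.
  by move=> BA AB; apply/seteqP.
have mE C : P C -> mu C = if setT == C then 1 else
    - \sum_(z \in [set z | [/\ P z, rev_incl setT z, rev_incl z C & z <> C]]) mu z.
  apply: (mobiusE intersection_poset_finite _ anti).
    by move=> A; exact: subset_refl.
  by move=> A B D BA DB; exact: subset_trans DB BA.
have finPE : finite_set [set C | P C /\ y `<=` C].
  by apply: sub_finite_set intersection_poset_finite => C [].
rewrite PE (fsbigD1 y) //=; last by split.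
rewrite mE //; case: eqVneq => [yT|yT].
  rewrite fsbig1 ?addr0; last first.
    move=> C [[_ yC] Cy]; exfalso; apply: Cy; apply/seteqP; split=> //.
    by rewrite -yT.
  rewrite asboolT // => -[i _ Hi].
  (* A hyperplane through [q] contains [y], which is the whole torus here. *)
  suff HT : H i = setT by have := H_proper HT.
  apply/seteqP; split=> // r _.
  have : y r by rewrite -yT.
  by move=> /connected_component_sub; apply; rewrite /= inE; exact/asboolP.
rewrite asboolF; last first.
  move=> Wq; move/eqP: yT; apply; apply/seteqP; split=> //.
  apply: connected_component_max => //; last exact: torus_connected.
  by move=> r' _ i /=; rewrite inE => /asboolP Hi; case: Wq; exists i.
apply/eqP; rewrite addrC subr_eq0; apply/eqP; apply: eq_fsbigl.
by apply/seteqP; split=> [C [[PC yC] Cy]|C [PC _ yC Cy]].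
Qed.

Lemma mobius_strata q : `[< W q >]%:Z =
  \sum_(C <- fset_set (P `\ set0)) mu C * `[< C q >]%:Z.
Proof.
rewrite -mobius_sum_strata -fsbig_finite; last first.
  by apply: sub_finite_set intersection_poset_finite => C [].
rewrite -(fsbig_widen [set C | P C /\ C q]).
- by apply: eq_fsbigr => C; rewrite inE => -[_ Cq]; rewrite asboolT // mulr1.
- by move=> C [PC Cq]; split=> // C0; rewrite C0 in Cq.
- move=> C [[PC C0] nC] /=; rewrite asboolF ?mulr0 // => Cq.
  by apply: nC.
Qed.

Lemma toric_char_poly0 : (toric_char_poly H).[0] =
  \sum_(C <- fset_set (P `\ set0)) mu C * (toric_dim C == 0%N)%:Z.
Proof.
rewrite /toric_char_poly fsbig_finite; last first.
  by apply: sub_finite_set intersection_poset_finite => C [].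
rewrite horner_sum; apply: eq_bigr => C _.
by rewrite hornerZ hornerXn expr0n natz.
Qed.

Lemma euler_complement_strata :
  euler (fun x => `[< W (pr x) >]%:Z) (toric_char_poly H).[0].
Proof.
rewrite toric_char_poly0.
apply: (@euler_ext _ _ (fun x => \sum_(C <- fset_set (P `\ set0))
    mu C * `[< C (pr x) >]%:Z)).
  by move=> x _; rewrite mobius_strata.
apply: euler_sum => C; rewrite in_fset_set; last first.
  by apply: sub_finite_set intersection_poset_finite => ? [].
rewrite inE => -[PC C0]; apply: eulerM.
have [S [x0 [_ k0 ->]]] := stratumP PC C0.
exact: euler_toric_subspace k0.
Qed.

(** An integral kernel vector [v] leaves the cell invariant, so the region contains the closed curve
    in direction [v], which [ball_no_loop] forbids. *)
Lemma region_essential C : regions H C -> homeomorphic C (unit_ball R n) ->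
  forall x : 'cV[R]_n, rmx a *m x = 0 -> x = 0.
Proof.
move=> /regionP[k [x0 [_ kx0 ->]]] ball x ax; apply/eqP; apply: contraT => x_neq0.
have [v v0 av] := integral_kernel x_neq0 ax.
move/eqP: v0; case; apply: (ball_no_loop ball) => s.
exists (x0 + s *: intv R v) => // i.
by rewrite mulmxDr -scalemxAr intv_mul av /intv map_mx0 scaler0 addr0; exact: kx0.
Qed.

(** [x] is recovered from [a x] by a left inverse, and the cell confines each coordinate of [a x] to
    a bounded interval. *)
Lemma cell_bounded k : (forall x : 'cV[R]_n, rmx a *m x = 0 -> x = 0) ->
  exists M : nat, forall x i, cell a b k x -> `|x i 0| < M%:R.
Proof.
move=> /col_injP; rewrite -mxrank_tr => /eqP/row_freeP[G GE].
have {}GE : G^T *m rmx a = 1%:M by rewrite -[rmx a]trmxK -trmx_mul GE trmx1.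
(* A bound for coordinate [i] of [a x], which lies between [k i + b i] and [k i + b i + 1]. *)
pose c i : R := `|b i 0| + `|(k i 0)%:~R| + 1.
pose B := \sum_j \sum_i `|G^T j i| * c i.
exists (Num.truncn B).+1 => x j kx; apply: le_lt_trans (truncnS_gt B).
rewrite -[x]mul1mx -GE -mulmxA mxE.
apply: le_trans (ler_norm_sum _ _ _) _.
rewrite /B (bigD1 j) //=.
apply: le_trans (_ : _ <= \sum_i `|G^T j i| * c i) _.
  apply: ler_sum => i _; rewrite normrM ler_wpM2l // /c.
  have := kx i; rewrite [(_ - b) i 0]mxE [(- b) i 0]mxE intrD => /andP[k1 k2].
  set y := (rmx a *m x) i 0 in k1 k2 *.
  have b1 := ler_norm (b i 0); have b2 := ler_norm (- b i 0).
  have k3 : (k i 0)%:~R <= `|(k i 0)%:~R| :> R by exact: ler_norm.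
  have k4 : - (k i 0)%:~R <= `|(k i 0)%:~R| :> R by rewrite -normrN; exact: ler_norm.
  rewrite normrN in b2; rewrite ler_norml; apply/andP; split; lra.
rewrite lerDl; apply: sumr_ge0 => l _; apply: sumr_ge0 => i _.
by rewrite mulr_ge0 // addr_ge0 // addr_ge0.
Qed.

Lemma cell_line_open k : line_open (cell a b k).
Proof.
move=> x v kx; pose l (s : R) := x + s *: v.
have cl : continuous l.
  by move=> s; apply: cvgD; [exact: cvg_cst|apply: cvgZr_tmp; exact: cvg_id].
have o := @open_cell_union R n m a b [set k].
have : nbhs (l 0) [set x | exists2 k', [set k] k' & cell a b k' x].
  by apply: open_nbhs_nbhs; split=> //; exists k; rewrite // /l scale0r addr0.
move=> /cl /nbhs_ballP[d /= d0 dP]; exists d => // s sd.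
by have [|_ /= -> //] := dP s; rewrite /ball /= sub0r normrN.
Qed.

(** The cell injects into the torus: if two translates of [x] by [z] and [z'] have the same label
    then [a z = a z'], so [z = z']. Its periodization is thus the indicator of the region. *)
Lemma euler_region C : (forall x : 'cV[R]_n, rmx a *m x = 0 -> x = 0) ->
  regions H C -> euler (fun x => `[< C (pr x) >]%:Z) ((-1) ^+ n).
Proof.
move=> inj /regionP[k [x0 [_ kx0 ->]]]; have [M MP] := cell_bounded k inj.
have := euler_periodize (@cell_convex R n m a b k) (@cell_line_open k) MP.
rewrite asboolT; last by exists x0.
apply: euler_ext => x bx; rewrite periodizeE //.
  congr (Posz (nat_of_bool _)); apply/asbool_equiv_eq; split.
    move=> [z kz]; exists (x + intv R z) => //.
    by apply/torus_projE; exists z.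
  by move=> [y ky /torus_projE[z yE]]; exists z; rewrite -yE.
move=> z z' /cell_shift/cellP[_ E] /cell_shift/cellP[_ E'].
have azz : a *m z = a *m z' by apply: oppr_inj; apply: (addrI k); rewrite -E -E'.
apply: (@intv_inj R); apply/eqP; rewrite -subr_eq0; apply/eqP/inj.
by rewrite mulmxBr !intv_mul azz subrr.
Qed.

End Arrangement.

Theorem theorem3p6 (R : realType) (n m : nat) (H : 'I_m -> set (torus R n))
  (hypH : forall i : 'I_m, toric_hyperplane (H i))
  (ballH : forall C : set (torus R n),
     regions H C -> homeomorphic C (unit_ball R n)) :
  finite_set (regions H) /\
  (#|` fset_set (regions H)|%fset)%:Z = (-1) ^+ n * (toric_char_poly H).[0].
Proof.
have /choice[f fP] : forall i, exists rb : 'rV[int]_n * R,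
    (exists z0 : 'cV[int]_n, (rb.1 *m z0) 0 0 = 1) /\
    forall x, H i (torus_proj x) <->
      (map_mx intr rb.1 *m x) 0 0 - rb.2 \is a Num.int.
  by move=> i; have [r [b rbP]] := toric_hyperplane_normal (hypH i); exists (r, b).
pose a : 'M[int]_(m, n) := \matrix_(i, j) (f i).1 0 j.
pose b : 'cV[R]_m := \col_i (f i).2.
have HE i x : H i (torus_proj x) <->
    (map_mx (intr : int -> R) a *m x - b) i 0 \is a Num.int.
  have [_ ->] := fP i; rewrite !mxE.
  by under [X in _ <-> X - _ \is a _]eq_bigr do rewrite !mxE;
     under [X in X - _ \is a _ <-> _]eq_bigr do rewrite !mxE.
(* Since [r z0 = 1], the point [(b + 1/2) z0] has offset 1/2 from the hyperplane, which is not an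
   integer. *)
have H_proper i : H i <> setT.
  move=> HT; have [[z0 z01] Hi] := fP i.
  have : H i (torus_proj (((f i).2 + 2^-1) *: intv R z0)) by rewrite HT.
  move=> /Hi; rewrite -scalemxAr intv_mul.
  move: (_ *m z0) z01 => M M1; rewrite !mxE M1 mulr1 addrC addKr => /intrP[k kE].
  have k2 : (2 * k)%:~R = 1%:~R :> R by rewrite intrM -kE mulfV.
  by move/intr_inj: k2; lia.
have fin := regions_finite HE; split=> //.
(* By uniqueness, the integral of the complement computed region by region equals the one computed
   from the strata; moving the sign across uses that its square is 1. *)
suff E : euler (fun x => `[< (~` \bigcup_i H i) (torus_proj x) >]%:Z)
    (\sum_(C <- fset_set (regions H)) (-1) ^+ n).
  have := euler_unique E (euler_complement_strata HE H_proper) => <-.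
  rewrite big_const_seq count_predT iter_addr_0 mulrnAr -expr2 sqrr_sign.
  by rewrite natz.
apply: (@euler_ext _ _ (fun x =>
    \sum_(C <- fset_set (regions H)) `[< C (torus_proj x) >]%:Z)).
  by move=> x _; rewrite (complement_regions HE).
apply: euler_sum => C; rewrite in_fset_set // inE => HC.
(* The injectivity of [a] is drawn from the ball hypothesis on the region [C] at hand. *)
by apply: (euler_region HE) => //; exact: region_essential HE _ HC (ballH _ HC).
Qed.
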